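(* Let $\phi$ be an acyclic Sturmian coloring of the $d$-regular tree $T$. Let $K\in[0,\infty]$ be such that, for $n\ge-1$, $S_n=A_n=C_n$ if and only if $n<K$, and let $(n_k)_{k\ge0}$ be the increasing sequence of the integers $n\ge0$ such that at least one of $A_n,B_n$ equals $S_n$ or $C_n$. All concatenations $\mathcal G^A_{n-1}\bowtie\mathcal G^B_{n-1}$ below are at $(C_{n-1},C_{n-1})$. (1) For $0\le n<K$ we have $A_n=C_n=S_n$, and for some $i,j$, $$\mathcal G^A_n\cong\mathcal G^A_{n-1},\qquad \mathcal G^B_n\cong\mathcal G^A_{n-1}\bowtie_{i,j}\mathcal G^B_{n-1}.$$ (2) For $n=K$ (if $K<\infty$) we have one of the following cases: (a) if $A_n=S_n$, $B_n=C_n$, then for some $i<i'$ and $j$, $$\mathcal G^A_n\cong\mathcal G^A_{n-1}\bowtie_{i,j}\mathcal G^B_{n-1},\qquad \mathcal G^B_n\cong\mathcal G^A_{n-1}\bowtie_{i',j}\mathcal G^B_{n-1};$$ (b) if $B_n=S_n$, then $C_n=\overline{B_{n-1}}$ and, for some $i,j$, $$\mathcal G^A_n\cong\mathcal G^A_{n-1}\bowtie_{i,j}\mathcal G^B_{n-1},\qquad\mathcal G^B_n\cong\mathcal G^B_{n-1}.$$ (3) For every $n>K$: if $n\ne n_k$ for all $k$, then $\mathcal G^A_n\cong\mathcal G^A_{n-1}$ and $\mathcal G^B_n\cong\mathcal G^B_{n-1}$; if $n=n_k$ for some $k$, then either $$\mathcal G^A_n\cong\mathcal G^A_{n-1}\bowtie\mathcal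 G^B_{n-1},\ \mathcal G^B_n\cong\mathcal G^B_{n-1}\quad\text{or}\quad \mathcal G^A_n\cong\mathcal G^A_{n-1},\ \mathcal G^B_n\cong\mathcal G^A_{n-1}\bowtie\mathcal G^B_{n-1},$$ where $\bowtie$ is either an $(i)$-concatenation or an $(i,j)$-concatenation.
   Context: Balls and Sturmian colorings. $T$ is a $d$-regular tree with vertex set $VT$ and path metric. For $\phi:VT\to\{a,b\}$, $\mathcal B_n(x)$ is the closed $n$-ball around $x$, colored by $\phi$; two $n$-balls are equivalent if there is a color-preserving isomorphism of balls between them (center to center); $[\mathcal B_n(x)]$ is the class, $\mathbf B_n(\phi)$ the set of classes. $\phi$ is Sturmian if $|\mathbf B_n(\phi)|=n+2$ for all $n\ge0$. Then for each $n\ge0$ there is a unique class $S_n$ (special $n$-ball) which is the restriction to the concentric $n$-ball of two distinct classes $A_{n+1},B_{n+1}$ of $(n+1)$-balls; any other class $D$ of $n$-balls has a unique extension $\overline D$ to an $(n+1)$-ball class. $C_n$ is the central $n$-ball of $S_{n+1}$. Naming: colors are named so that $S_0=A_0=[a]$, $B_0=[b]$. $D$ is always adjacent to $E$ if every ball of class $D$ has its center at distance 1 from the center of some ball of class $E$. Inductively $A_{n+1}$ is always adjacent to $A_n$, $B_{n+1}$ to $B_n$, and the center of $A_{n+1}$ has more neighbors with $n$-ball in class $A_n$ than that of $B_{n+1}$. $S_{-1}=A_{-1}=C_{-1}$ is the empty ball. Graphs. $\mathcal G_n$ has vertex set $\mathbf B_n(\phi)$, with an edge between $D,E$ if there are $x,y\in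 VT$ at distance 1 with $[\mathcal B_n(x)]=D,[\mathcal B_n(y)]=E$. A cycle has length $>1$ (loops are not cycles); $\phi$ is acyclic if no $\mathcal G_n$ has a cycle. For $X\neq S_n$, $i_A(X,Y)=i_B(X,Y)=i(X,Y)$ is the number of $n$-balls of class $Y$ centered at neighbors of the center of a ball of class $X$; $i_A(S_n,Y)$ (resp. $i_B(S_n,Y)$) is the number of those centered at neighbors of the center of $A_{n+1}$ (resp. $B_{n+1}$). $\mathcal G^A_n$ is the edge-indexed graph on the classes reachable from $S_n$ by oriented edges of positive $i_A$, with the oriented edges (and loops) of positive $i_A$, indexed by $i_A$; $\mathcal G^B_n$ likewise with $i_B$. $\mathcal G^A_{-1}=\mathcal G^B_{-1}$ is a single vertex (the empty ball) with a loop of index $d$. $\cong$ is isomorphism of edge-indexed graphs. Concatenation. For edge-indexed graphs $\mathcal G_1,\mathcal G_2$ with end vertices $V,V'$ (vertices with at most one non-loop edge), let $m_1,\ell_1$ (resp. $m_2,\ell_2$) be the indices of the non-loop edge and of the loop at $V$ (resp. $V'$), index 0 meaning absence. (a) If $m_1=m_2=m$, $\ell_1=\ell_2=\ell$, $1\le i<m$: the $(i)$-concatenation $\mathcal G_1\bowtie_i\mathcal G_2$ at $(V,V')$ identifies $V$ and $V'$ (and their loops) in the disjoint union; at that vertex the edge into $\mathcal G_1$ gets index $i$, the edge into $\mathcal G_2$ gets $m-i$, the loop has index $\ell$. (b) For $1\le i\le\ell_1$, $1\le j\le\ell_2$: the $(i,j)$-concatenation $\mathcal G_1\bowtie_{i,j}\mathcal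 G_2$ at $(V,V')$ is the disjoint union plus a new edge of index $i$ from $V$ to $V'$ and $j$ from $V'$ to $V$; the loops at $V,V'$ get indices $\ell_1-i,\ell_2-j$ (index 0 meaning no loop). All other indices are unchanged. *)

(* Defs.v *)
From HB Require Import structures.
From mathcomp Require Import all_boot.
From mathcomp Require Import boolp classical_sets functions cardinality.

Set Implicit Arguments.
Unset Strict Implicit.
Unset Printing Implicit Defensive.

Local Open Scope classical_set_scope.

(* The vertices at distance 1 from x are listed, without repetition, by
   [nbr x].  In [rt_acyclic], the sequence x :: y :: nil formed by two adjacent
   vertices satisfies [ucycle], hence the bound on the size. *)
Record regular_tree (d : nat) := RegularTree {
  tvertex :> eqType;
  nbr : tvertex -> seq tvertex;
  rt_uniq : forall x, uniq (nbr x);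
  rt_degree : forall x, size (nbr x) = d;
  rt_sym : forall x y, (y \in nbr x) = (x \in nbr y);
  rt_irrefl : forall x, x \notin nbr x;
  rt_connected : forall x y, exists2 p, path (grel nbr) x p & last x p = y;
  rt_acyclic : forall s, 2 < size s -> ~ ucycle (grel nbr) s }.

Inductive color := col_a | col_b.

Definition ball (d : nat) (T : regular_tree d) (n : nat) (x : T) : set T :=
  [set y | exists p, [/\ path (grel (@nbr d T)) x p, last x p = y & size p <= n]].

Definition ball_equiv (d : nat) (T : regular_tree d) (phi : T -> color) (n : nat)
    (x y : T) : Prop :=
  exists f : T -> T,
    [/\ set_bij (ball n x) (ball n y) f,
        f x = y,
        forall u v, ball n x u -> ball n x v -> (f v \in nbr (f u)) = (v \in nbr u)
      & forall u, ball n x u -> phi (f u) = phi u].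

(* An equivalence class of n-balls is represented by the set of the centers of
   the n-balls in the class.  Classes are only compared at the same radius: a
   class of n-balls and its unique extension have the same set of centers. *)
Definition bclass (d : nat) (T : regular_tree d) (phi : T -> color) (n : nat) (x : T)
    : set T :=
  [set y | ball_equiv phi n x y].

Definition bclasses (d : nat) (T : regular_tree d) (phi : T -> color) (n : nat)
    : set (set T) :=
  range (bclass phi n).

Definition sturmian (d : nat) (T : regular_tree d) (phi : T -> color) : Prop :=
  forall n, (bclasses phi n #= `I_n.+2)%card.

(* D, a class of n-balls, is the restriction to the concentric n-ball of E, a
   class of (n+1)-balls. *)
Definition restricts_to (d : nat) (T : regular_tree d) (phi : T -> color) (n : nat)
    (E D : set T) : Prop :=
  exists x, E = bclass phi n.+1 x /\ D = bclass phi n x.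

Definition unique_extension (d : nat) (T : regular_tree d) (phi : T -> color) (n : nat)
    (D E : set T) : Prop :=
  forall E', restricts_to phi n E' D <-> E' = E.

Definition always_adjacent (d : nat) (T : regular_tree d) (D E : set T) : Prop :=
  forall x, D x -> exists2 y, y \in nbr x & E y.

Definition nbr_count (d : nat) (T : regular_tree d) (phi : T -> color) (n : nat)
    (x : T) (Y : set T) : nat :=
  count (fun y => bclass phi n y == Y) (nbr x).

Record naming (d : nat) (T : regular_tree d) (phi : T -> color)
    (S A B C : nat -> set T) : Prop := Naming {
  nm_A0 : A 0 = [set x | phi x = col_a];
  nm_B0 : B 0 = [set x | phi x = col_b];
  nm_S0 : S 0 = A 0;
  nm_special : forall n E, restricts_to phi n E (S n) <-> E = A n.+1 \/ E = B n.+1;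
  nm_distinct : forall n, A n.+1 <> B n.+1;
  nm_center : forall n, restricts_to phi n (S n.+1) (C n);
  nm_adjA : forall n, always_adjacent (A n.+1) (A n);
  nm_adjB : forall n, always_adjacent (B n.+1) (B n);
  nm_more : forall n x y, A n.+1 x -> B n.+1 y ->
    nbr_count phi n y (A n) < nbr_count phi n x (A n) }.

Definition class_adj (d : nat) (T : regular_tree d) (phi : T -> color) (n : nat)
    (D E : set T) : bool :=
  `[< exists x y, [/\ y \in nbr x, bclass phi n x = D & bclass phi n y = E] >].

(* Loops are not cycles, and two classes are joined by at most one edge, so the
   cycles of the graph of classes have at least three vertices. *)
Definition acyclic_coloring (d : nat) (T : regular_tree d) (phi : T -> color) : Prop :=
  forall n (s : seq (set T)), 2 < size s -> ~ ucycle (class_adj phi n) s.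

(* Edge-indexed graphs: there is an oriented edge from x to y (a loop if x = y)
   when [eidx x y] is positive, and [eidx x y] is then its index.  The values
   of [eidx] outside [evert] are irrelevant. *)
Record eigraph (V : eqType) := EIGraph {
  evert : set V;
  eidx : V -> V -> nat }.

Definition eisom (V W : eqType) (G : eigraph V) (H : eigraph W) : Prop :=
  exists f : V -> W, set_bij (evert G) (evert H) f /\
    forall x y, evert G x -> evert G y -> eidx H (f x) (f y) = eidx G x y.

Notation "G ≅ H" := (eisom G H) (at level 70, no associativity).

Definition eadj (V : eqType) (G : eigraph V) (v x : V) : Prop :=
  [/\ evert G x, x <> v & 0 < eidx G v x \/ 0 < eidx G x v].

Definition end_vertex (V : eqType) (G : eigraph V) (v : V) : Prop :=
  evert G v /\ forall x y, eadj G v x -> eadj G v y -> x = y.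

(* m is the index of the non-loop edge at the end vertex v, and 0 if there is
   no such edge. *)
Definition end_index (V : eqType) (G : eigraph V) (v : V) (m : nat) : Prop :=
  (exists2 x, eadj G v x & m = eidx G v x) \/
  ((forall x, ~ eadj G v x) /\ m = 0).

(* Underlying graph of the (i)-concatenation of G1 and G2 at (v1, v2), where m
   is the common index of the non-loop edges at v1 and v2.  The vertex obtained
   by identifying v1 and v2 is [inl v1]. *)
Definition concat1 (V W : eqType) (G1 : eigraph V) (v1 : V) (G2 : eigraph W) (v2 : W)
    (m i : nat) : eigraph (V + W)%type :=
  EIGraph
    [set z | match z with
             | inl x => evert G1 x
             | inr y => evert G2 y /\ y <> v2
             end]
    (fun z z' =>
       match z, z' with
       | inl x, inl x' =>
           if (x == v1) && (x' != v1)
           then (if 0 < eidx G1 v1 x' then i else 0) else eidx G1 x x'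
       | inl x, inr y' =>
           if x == v1 then (if 0 < eidx G2 v2 y' then m - i else 0) else 0
       | inr y, inl x' => if x' == v1 then eidx G2 y v2 else 0
       | inr y, inr y' => eidx G2 y y'
       end).

(* Underlying graph of the (i,j)-concatenation of G1 and G2 at (v1, v2). *)
Definition concat2 (V W : eqType) (G1 : eigraph V) (v1 : V) (G2 : eigraph W) (v2 : W)
    (i j : nat) : eigraph (V + W)%type :=
  EIGraph
    [set z | match z with inl x => evert G1 x | inr y => evert G2 y end]
    (fun z z' =>
       match z, z' with
       | inl x, inl x' =>
           if (x == v1) && (x' == v1) then eidx G1 v1 v1 - i else eidx G1 x x'
       | inl x, inr y' => if (x == v1) && (y' == v2) then i else 0
       | inr y, inl x' => if (y == v2) && (x' == v1) then j else 0
       | inr y, inr y' =>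
           if (y == v2) && (y' == v2) then eidx G2 v2 v2 - j else eidx G2 y y'
       end).

(* The (i)-concatenation of G1 and G2 at (v1, v2) is defined, and G is
   isomorphic to it. *)
Definition isom_concat1 (U V W : eqType) (G : eigraph U)
    (G1 : eigraph V) (v1 : V) (G2 : eigraph W) (v2 : W) (i : nat) : Prop :=
  exists m,
    [/\ end_vertex G1 v1 /\ end_vertex G2 v2,
        end_index G1 v1 m /\ end_index G2 v2 m,
        eidx G1 v1 v1 = eidx G2 v2 v2,
        1 <= i < m
      & G ≅ concat1 G1 v1 G2 v2 m i].

(* The (i,j)-concatenation of G1 and G2 at (v1, v2) is defined, and G is
   isomorphic to it. *)
Definition isom_concat2 (U V W : eqType) (G : eigraph U)
    (G1 : eigraph V) (v1 : V) (G2 : eigraph W) (v2 : W) (i j : nat) : Prop :=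
  [/\ end_vertex G1 v1 /\ end_vertex G2 v2,
      1 <= i <= eidx G1 v1 v1,
      1 <= j <= eidx G2 v2 v2
    & G ≅ concat2 G1 v1 G2 v2 i j].

Definition isom_concat (U V W : eqType) (G : eigraph U)
    (G1 : eigraph V) (v1 : V) (G2 : eigraph W) (v2 : W) : Prop :=
  (exists i, isom_concat1 G G1 v1 G2 v2 i) \/
  (exists i j, isom_concat2 G G1 v1 G2 v2 i j).

(* The value of [nbr_count phi n x Y] at any x in X.  It does not depend on x
   when X is a class of (n+1)-balls, or a class of n-balls having a unique
   extension. *)
Definition class_count (d : nat) (T : regular_tree d) (phi : T -> color) (n : nat)
    (X Y : set T) : nat :=
  xget 0 [set k | exists2 x, X x & k = nbr_count phi n x Y].

(* The index i_A for E = A_(n+1), and i_B for E = B_(n+1). *)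
Definition class_index (d : nat) (T : regular_tree d) (phi : T -> color) (n : nat)
    (Sn E : set T) (X Y : set T) : nat :=
  class_count phi n (if X == Sn then E else X) Y.

Inductive reachable (V : Type) (w : V -> V -> nat) (x : V) : V -> Prop :=
  | reach_refl : reachable w x x
  | reach_step y z : reachable w x y -> 0 < w y z -> reachable w x z.

(* [class_graph phi S A n] is G^A_n and [class_graph phi S B n] is G^B_n. *)
Definition class_graph (d : nat) (T : regular_tree d) (phi : T -> color)
    (S E : nat -> set T) (n : nat) : eigraph (set T) :=
  let w := class_index phi n (S n) (E n.+1) in
  EIGraph (reachable w (S n)) w.

(* [class_graph_pred phi S A n] is G^A_(n-1), and [class_pred C n] is C_(n-1).
   At level -1 every vertex is the center of the empty ball, whose class is
   therefore represented by [setT]. *)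
Definition class_graph_pred (d : nat) (T : regular_tree d) (phi : T -> color)
    (S E : nat -> set T) (n : nat) : eigraph (set T) :=
  if n is k.+1 then class_graph phi S E k
  else EIGraph [set setT] (fun _ _ => d).

Definition class_pred (d : nat) (T : regular_tree d) (C : nat -> set T) (n : nat) : set T :=
  if n is k.+1 then C k else setT.

(* Order on [0, oo], the value oo being [None]. *)
Definition lt_ext (n : nat) (K : option nat) : Prop :=
  if K is Some k then n < k else True.

Definition gt_ext (n : nat) (K : option nat) : Prop :=
  if K is Some k then k < n else False.

(* n is one of the integers n_k. *)
Definition concat_level (d : nat) (T : regular_tree d) (S A B C : nat -> set T)
    (n : nat) : Prop :=
  [\/ A n = S n, A n = C n, B n = S n | B n = C n].

(* Main.v *)
(* Passing from radius n to n+1 splits the single class S_n into A_(n+1) and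
   B_(n+1), and keeps every other class (as a set of centers).  Since the naming
   makes A_(n+1) and B_(n+1) differ in their numbers of neighbors in A_n and B_n,
   S_n is adjacent in G_n to both A_n and B_n.  As G_n has no cycle, a class
   other than S_n that becomes adjacent to both A_(n+1) and B_(n+1) is unique: it
   is C_n.  Hence every neighbor of S_n other than A_n and B_n is C_n, and so is
   B_n (resp. A_n) if it is a neighbor of A_(n+1) (resp. B_(n+1)) distinct from S_n.
   This controls all the indices at S_n.

   On the other side, G^A_(n-1) is the component of A_n in G_n deprived of B_n,
   with A_n renamed S_(n-1), and similarly for G^B_(n-1).  If S_n is A_n or B_n,
   these two components are disjoint and joined by the edge between A_n and B_n,
   which gives an (i,j)-concatenation; otherwise they meet in S_n = C_(n-1) only,
   which gives an (i)-concatenation.  When B_n is not reached from A_(n+1), only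
   the component of A_n remains and G^A_n is G^A_(n-1).

   If A_n = S_n is a leaf of G_n, then the same holds at all smaller radii; this
   separates the radii n <= K from the others, and the analogous statement for
   B_n = S_n contradicts S_0 = A_0. *)

Require Import Defs.
From mathcomp Require Import all_boot.
From mathcomp Require Import boolp classical_sets functions cardinality.

Set Implicit Arguments.
Unset Strict Implicit.
Unset Printing Implicit Defensive.

Local Open Scope classical_set_scope.

(** * Equivalence of balls *)

Section Balls.
Variables (d : nat) (T : regular_tree d) (phi : T -> color).

Lemma ball_center n (x : T) : ball n x x.
Proof. by exists [::]. Qed.

Lemma ball_le m n (x y : T) : m <= n -> ball m x y -> ball n x y.
Proof. by move=> mn [p [pp lp sp]]; exists p; split=> //; apply: leq_trans mn. Qed.

Lemma ball_cat m n (x y z : T) : ball m x y -> ball n y z -> ball (m + n) x z.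
Proof.
move=> [p [pp lp sp]] [q [pq lq sq]]; exists (p ++ q); split.
- by rewrite cat_path pp lp.
- by rewrite last_cat lp.
- by rewrite size_cat leq_add.
Qed.

Lemma ball1 (x y : T) : y \in nbr x -> ball 1 x y.
Proof. by move=> xy; exists [:: y]; split=> //=; rewrite xy. Qed.

(** An equivalence of balls induces one on every smaller ball inside, centered or not. Paths within
    the ball are mapped to paths ([fwd]). Conversely, a path from the image of a vertex lifts step
    by step ([bwd]): its next vertex is still in the ball around [y], hence in the image of [f], and
    [f] reflects adjacency there. The cases [j = 0] and [j = 1] give the restriction of classes and
    the classes of the neighbors. *)
Lemma ball_equiv_restrict n (x y : T) (f : T -> T) j k u :
    set_bij (ball n x) (ball n y) f -> f x = y ->
    (forall u v, ball n x u -> ball n x v -> (f v \in nbr (f u)) = (v \in nbr u)) ->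
    (forall u, ball n x u -> phi (f u) = phi u) ->
    ball j x u -> j + k <= n -> ball_equiv phi k u (f u).
Proof.
move=> [fto finj fonto] fx fadj fphi.
have fwd p : forall i v, ball i x v -> i + size p <= n -> path (grel (@nbr d T)) v p ->
    path (grel (@nbr d T)) (f v) (map f p).
  elim: p => [//|w p IHp] i v iv /= ile /andP[vw pp].
  have iw : ball i.+1 x w by rewrite -addn1; apply: ball_cat iv (ball1 vw).
  rewrite (IHp i.+1) ?andbT ?addSnnS // fadj //.
    by apply: ball_le iv; apply: leq_trans ile; rewrite leq_addr.
  by apply: ball_le iw; apply: leq_trans ile; rewrite addnS ltnS leq_addr.
have fball i v l w : ball i x v -> i + l <= n -> ball l v w -> ball l (f v) (f w).
  move=> iv il [p [pp <- sp]]; exists (map f p); rewrite last_map size_map.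
  by split=> //; apply: (fwd p i) => //; apply: leq_trans il; rewrite leq_add2l.
have bwd q : forall i v, ball i x v -> i + size q <= n -> path (grel (@nbr d T)) (f v) q ->
    exists p, [/\ path (grel (@nbr d T)) v p, f (last v p) = last (f v) q & size p = size q].
  elim: q => [|z q IHq] i v iv /=; first by exists [::].
  move=> ile /andP[vz pq].
  have i1n : i.+1 <= n by apply: leq_trans ile; rewrite addnS ltnS leq_addr.
  have yz : ball n y z.
    apply: (ball_le i1n); rewrite -addn1 -fx; apply: ball_cat _ (ball1 vz).
    exact: (fball 0 x i v (ball_center 0 x) (ltnW i1n) iv).
  have [w nw wz] := fonto z yz; subst z.
  have vw : w \in nbr v by rewrite -fadj //; apply: ball_le iv; apply: ltnW.
  have iw : ball i.+1 x w by rewrite -addn1; apply: ball_cat iv (ball1 vw).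
  rewrite addnS -addSn in ile.
  have [p [pp lp sp]] := IHq _ _ iw ile pq.
  by exists (w :: p); split; rewrite /= ?vw ?sp.
move=> ju jk; have kn v : ball k u v -> ball n x v.
  by move=> kv; apply: ball_le jk _; apply: ball_cat ju kv.
exists f; split=> //.
- split.
  + by move=> v kv; apply: (fball j).
  + by move=> v w /set_mem kv /set_mem kw; apply: finj; apply/mem_set/kn.
  + move=> z [q [pq lq sq]].
    have jq : j + size q <= n by apply: leq_trans jk; rewrite leq_add2l.
    have [p [pp lp sp]] := bwd q j u ju jq pq.
    by exists (last u p); rewrite ?lp //; exists p; rewrite sp.
- by move=> v w kv kw; apply: fadj; apply: kn.
- by move=> v kv; apply/fphi/kn.
Qed.

Lemma ball_equiv_refl n (x : T) : ball_equiv phi n x x.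
Proof. by exists id; split=> //; split=> // y; exists y. Qed.

Lemma ball_equiv_sym n (x y : T) : ball_equiv phi n x y -> ball_equiv phi n y x.
Proof.
move=> [f [[fto finj fonto] fx fadj fphi]].
have [g gP] : {g : T -> T & forall v, ball n y v -> ball n x (g v) /\ f (g v) = v}.
  apply: (@choice T T (fun v w => ball n y v -> ball n x w /\ f w = v)) => v.
  have [/fonto[w xw wv]|nv] := pselect (ball n y v); first by exists w.
  by exists v.
have gf u : ball n x u -> g (f u) = u.
  move=> xu; have [xg fg] := gP _ (fto _ xu).
  by apply: finj fg; apply/mem_set.
exists g; split.
- split.
  + by move=> v yv; have [] := gP v yv.
  + move=> v w /set_mem yv /set_mem yw E.
    by have [_ <-] := gP v yv; have [_ <-] := gP w yw; rewrite E.
  + by move=> u xu; exists (f u); [apply: fto|apply: gf].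
- by rewrite -fx gf //; apply: ball_center.
- move=> u v yu yv; have [xu fu] := gP u yu; have [xv fv] := gP v yv.
  by rewrite -fadj // fu fv.
- by move=> u yu; have [xu fu] := gP u yu; rewrite -fphi // fu.
Qed.

Lemma ball_equiv_trans n (x y z : T) :
  ball_equiv phi n x y -> ball_equiv phi n y z -> ball_equiv phi n x z.
Proof.
move=> [f [fbij fx fadj fphi]] [g [gbij gy gadj gphi]].
have fto u : ball n x u -> ball n y (f u).
  by move=> xu; have [h _ _] := fbij; apply: h.
exists (g \o f); split.
- exact: set_bij_comp fbij gbij.
- by rewrite /= fx.
- by move=> u v xu xv; rewrite /= gadj ?fadj //; apply: fto.
- by move=> u xu; rewrite /= gphi ?fphi //; apply: fto.
Qed.

Lemma bclassE n (x y : T) : bclass phi n x y <-> bclass phi n x = bclass phi n y.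
Proof.
split=> [xy|->]; last exact: ball_equiv_refl.
apply/seteqP; split=> z.
  by apply: ball_equiv_trans; apply: ball_equiv_sym.
exact: ball_equiv_trans.
Qed.

Lemma bclass0 (x y : T) : phi x = phi y <-> bclass phi 0 x = bclass phi 0 y.
Proof.
split=> [xy|/bclassE[f [_ fx _ fphi]]]; last first.
  by rewrite -fx fphi //; apply: ball_center.
have b0 z w : ball 0 z w <-> w = z :> T.
  split=> [[[|a p] [_ //=]]|->]; last exact: ball_center.
apply/bclassE; exists (fun=> y); split=> //.
- split.
  + by move=> v _; apply: ball_center.
  + by move=> v w /set_mem/b0 -> /set_mem/b0 ->.
  + by move=> v /b0 ->; exists x => //; apply: ball_center.
- move=> u v /b0 -> /b0 ->.
  by rewrite (negPf (rt_irrefl x)) (negPf (rt_irrefl y)).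
- by move=> u /b0 ->.
Qed.

Lemma bclass_restrict n (x y : T) :
  bclass phi n.+1 x = bclass phi n.+1 y -> bclass phi n x = bclass phi n y.
Proof.
move=> /bclassE[f [fbij fx fadj fphi]]; apply/bclassE; rewrite -fx.
by apply: (ball_equiv_restrict fbij fx fadj fphi (ball_center 0 x)).
Qed.

(** An equivalence of the balls of radius [n.+1] maps the neighbors of [x] bijectively to those of
    [y], and restricts to an equivalence of the [n]-balls around them. *)
Lemma bclass_nbr_count n (x y : T) (Y : set T) :
  bclass phi n.+1 x = bclass phi n.+1 y -> nbr_count phi n x Y = nbr_count phi n y Y.
Proof.
move=> /bclassE[f [fbij fx fadj fphi]]; have [fto finj fonto] := fbij.
have nb u : u \in nbr x -> ball n.+1 x u by move=> /ball1; apply: ball_le.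
have /permP perm : perm_eq (map f (nbr x)) (nbr y).
  apply: uniq_perm; rewrite ?rt_uniq //.
    rewrite map_inj_in_uniq ?rt_uniq // => u v /nb xu /nb xv.
    by apply: finj; apply/mem_set.
  move=> z; apply/mapP/idP => [[u xu ->]|yz].
    by rewrite -fx fadj //; [apply: ball_center|apply: nb].
  have [|u xu uz] := fonto z; first by apply: ball_le (ball1 yz).
  by exists u => //; rewrite -fadj // ?fx ?uz //; apply: ball_center.
rewrite /nbr_count -perm count_map; apply: eq_in_count => u xu /=.
congr (_ == _); apply/bclassE.
by apply: (ball_equiv_restrict fbij fx fadj fphi (ball1 xu)); rewrite add1n.
Qed.

End Balls.

(** * Splitting of the special class *)

Lemma card_eq_seq (U : Type) (X : set (set U)) m :
  (X #= `I_m)%card -> exists s : seq (set U), [/\ uniq s, size s = m & forall x, X x <-> x \in s].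
Proof.
move=> /card_esym /card_set_bijP[f [fto finj fonto]].
exists (map f (iota 0 m)); rewrite size_map size_iota; split=> //.
  rewrite map_inj_in_uniq ?iota_uniq // => i j.
  by rewrite !mem_iota /= !add0n => im jm; apply: finj; apply/mem_set.
move=> x; split=> [/fonto[i im <-]|/mapP[i]].
  by apply: map_f; rewrite mem_iota.
by rewrite mem_iota add0n /= => im ->; apply: fto.
Qed.

Section Sturmian.
Variables (d : nat) (T : regular_tree d) (phi : T -> color).
Hypothesis phi_sturmian : sturmian phi.

(** By counting: choose one extension for each of the [n+2] classes of [n]-balls. If the class of
    [x] also had two extensions, a second extension of the class of [S] and one of the class of [x]
    would make [n+4] classes of radius [n+1], instead of [n+3]. *)
Lemma sturmian_extension n (S x1 x2 x y : T) :
  bclass phi n x1 = bclass phi n S -> bclass phi n x2 = bclass phi n S ->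
  bclass phi n.+1 x1 <> bclass phi n.+1 x2 ->
  bclass phi n x <> bclass phi n S -> bclass phi n y = bclass phi n x ->
  bclass phi n.+1 y = bclass phi n.+1 x.
Proof.
move=> x1S x2S x12 xS yx; apply: contrapT => yx'.
have [s [us ss sP]] := card_eq_seq (phi_sturmian n).
have [s' [us' ss' s'P]] := card_eq_seq (phi_sturmian n.+1).
have [rep repP] : {rep : set T -> T &
    forall X, (exists z, bclass phi n z = X) -> bclass phi n (rep X) = X}.
  apply: (@choice _ _ (fun X w => (exists z, bclass phi n z = X) -> bclass phi n w = X)) => X.
  by have [[z zX]|nX] := pselect (exists z, bclass phi n z = X); [exists z|exists S].
have repE z : bclass phi n (rep (bclass phi n z)) = bclass phi n z by apply: repP; exists z.
(* Of two distinct extensions of the same class, this is one that differs from the chosen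
   extension. *)
pose other z1 z2 := if bclass phi n.+1 (rep (bclass phi n z1)) == bclass phi n.+1 z1
                    then bclass phi n.+1 z2 else bclass phi n.+1 z1.
have otherP z1 z2 : bclass phi n z1 = bclass phi n z2 ->
    bclass phi n.+1 z1 <> bclass phi n.+1 z2 ->
    exists z, [/\ other z1 z2 = bclass phi n.+1 z, bclass phi n z = bclass phi n z1
      & bclass phi n.+1 z <> bclass phi n.+1 (rep (bclass phi n z))].
  move=> z12 z12'; rewrite /other; case: eqP => h.
    by exists z2; split=> //; rewrite -z12 h => /esym.
  by exists z1; split=> // /esym.
have [u [uE ux1 ur]] := otherP x1 x2 (etrans x1S (esym x2S)) x12.
have [v [vE vy vr]] := otherP y x yx yx'.
pose l := [:: bclass phi n.+1 u, bclass phi n.+1 v & [seq bclass phi n.+1 (rep X) | X <- s]].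
have ul : uniq l.
  rewrite /l /= map_inj_in_uniq ?us ?andbT.
    rewrite inE negb_or -andbA; apply/and3P; split.
    - apply/eqP => /bclass_restrict uv; apply: xS.
      by rewrite -yx -vy -uv ux1.
    - apply/negP => /mapP[X /sP[z _ <-]] uz; apply: ur; rewrite uz.
      by move/bclass_restrict: uz; rewrite repE => ->.
    - apply/negP => /mapP[X /sP[z _ <-]] uz; apply: vr; rewrite uz.
      by move/bclass_restrict: uz; rewrite repE => ->.
  by move=> X Y /sP[z _ <-] /sP[w _ <-] /bclass_restrict; rewrite !repE.
have : size l <= size s'.
  apply: uniq_leq_size => // X; rewrite !inE => /or3P[/eqP->|/eqP->|/mapP[Y _ ->]];
    by apply/s'P; eexists.
by rewrite /l /= size_map ss ss' ltnn.
Qed.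

End Sturmian.

Lemma reachable_path (V : eqType) (w : V -> V -> nat) x y : reachable w x y ->
  exists2 p, path (fun a b => 0 < w a b) x p & last x p = y.
Proof.
elim=> [|{}y z _ [p pp lp] yz]; first by exists [::].
by exists (rcons p z); rewrite ?last_rcons // rcons_path pp lp.
Qed.

Lemma reachable_step (V : Type) (w : V -> V -> nat) x y : 0 < w x y -> reachable w x y.
Proof. by move=> xy; apply: reach_step xy; apply: reach_refl. Qed.

(** * Classes and neighbor counts, with shifted radius *)

Section Levels.
Variables (d : nat) (T : regular_tree d) (phi : T -> color).

(* Radii are shifted by one, so that level 0 is the empty ball. *)
Definition lev n (x : T) : set T := if n is k.+1 then bclass phi k x else setT.

Definition lcount n (x : T) (Y : set T) := count (fun y => lev n y == Y) (nbr x).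

Lemma lev_mem n (x y : T) : lev n x y <-> lev n y = lev n x.
Proof. by case: n => [|n] //=; split=> [/bclassE|h]; [|apply/bclassE]. Qed.

Lemma lev_restrict n (x y : T) : lev n.+1 x = lev n.+1 y -> lev n x = lev n y.
Proof. by case: n => [|n] //; apply: bclass_restrict. Qed.

Lemma lcount_lev n (x y : T) Y : lev n.+1 x = lev n.+1 y -> lcount n x Y = lcount n y Y.
Proof.
case: n => [|n]; last exact: bclass_nbr_count.
move=> _; rewrite /lcount /=; case: (_ == Y); first by rewrite !count_predT !rt_degree.
by rewrite !count_pred0.
Qed.

Lemma lcount_gt0 n x Y : (0 < lcount n x Y) = has (fun y => lev n y == Y) (nbr x).
Proof. by rewrite has_count. Qed.

Lemma class_adj_nbr n x y : y \in nbr x -> class_adj phi n (lev n.+1 x) (lev n.+1 y).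
Proof. by move=> xy; apply/asboolP; exists x, y. Qed.

Lemma class_adj_lcount n x Y : 0 < lcount n.+1 x Y -> class_adj phi n (lev n.+1 x) Y.
Proof. by rewrite lcount_gt0 => /hasP[y xy /eqP <-]; apply: class_adj_nbr. Qed.

Lemma class_adjP n X Y : class_adj phi n X Y ->
  exists x y, [/\ y \in nbr x, lev n.+1 x = X & lev n.+1 y = Y].
Proof. by move=> /asboolP. Qed.

Lemma class_adj_sym n : symmetric (class_adj phi n).
Proof.
by move=> X Y; apply/idP/idP => /class_adjP[x [y [xy <- <-]]]; apply: class_adj_nbr;
   rewrite rt_sym.
Qed.

Lemma class_adj_lcountP n X Y :
  class_adj phi n X Y -> exists2 x, lev n.+1 x = X & 0 < lcount n.+1 x Y.
Proof.
move=> /class_adjP[x [y [xy xX yY]]]; exists x => //; rewrite lcount_gt0.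
by apply/hasP; exists y => //; apply/eqP.
Qed.

Lemma lcount0 x : lcount 0 x setT = d.
Proof.
rewrite -[RHS](rt_degree x) -[RHS]count_predT; apply: eq_count => y.
by rewrite /lev eqxx.
Qed.

End Levels.

Arguments lev : simpl never.
Arguments lcount : simpl never.

(* E and F are A and B, in either order. *)
Record splitting (d : nat) (T : regular_tree d) (phi : T -> color)
    (S E F C : nat -> set T) : Prop := Splitting {
  sp_cases : forall n x, lev phi n x = class_pred S n ->
    lev phi n.+1 x = E n \/ lev phi n.+1 x = F n;
  sp_keep : forall n x, lev phi n x <> class_pred S n -> lev phi n.+1 x = lev phi n x;
  sp_E : forall n, exists2 x, lev phi n x = class_pred S n & lev phi n.+1 x = E n;
  sp_F : forall n, exists2 x, lev phi n x = class_pred S n & lev phi n.+1 x = F n;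
  sp_neq : forall n, E n <> F n;
  sp_moreE : forall n x y, lev phi n.+2 x = E n.+1 -> lev phi n.+2 y = F n.+1 ->
    lcount phi n.+1 y (E n) < lcount phi n.+1 x (E n);
  sp_center : forall n, exists2 x, lev phi n.+2 x = S n.+1 & lev phi n.+1 x = C n }.

(** * Neighbors of the special class in an acyclic coloring *)

Section Splitting.
Variables (d : nat) (T : regular_tree d) (phi : T -> color).
Implicit Types (S E F C : nat -> set T) (X Y Z : set T).

Local Notation lev := (lev phi).
Local Notation lcount := (lcount phi).
Local Notation adj := (class_adj phi).

Lemma lev_E S E F C n x : splitting phi S E F C ->
  lev n.+1 x = E n -> lev n x = class_pred S n.
Proof. by move=> sp; have [y yS yE] := sp_E sp n; rewrite -yE -yS => /lev_restrict. Qed.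

Lemma lev_F S E F C n x : splitting phi S E F C ->
  lev n.+1 x = F n -> lev n x = class_pred S n.
Proof. by move=> sp; have [y yS yF] := sp_F sp n; rewrite -yF -yS => /lev_restrict. Qed.

Lemma lcount_split S E F C n x : splitting phi S E F C ->
  lcount n x (class_pred S n) = lcount n.+1 x (E n) + lcount n.+1 x (F n).
Proof.
move=> sp; rewrite /lcount -count_predUI (eq_count (a2 := predU (fun y => lev n.+1 y == E n)
  (fun y => lev n.+1 y == F n))); last first.
  move=> y; apply/eqP/orP => [/(sp_cases sp)[]/eqP|[]/eqP]; [by left|by right| |].
    exact: lev_E sp.
  exact: lev_F sp.
rewrite [X in _ = _ + X](eq_count (a2 := pred0)) ?count_pred0 ?addn0 // => y /=.
by apply/andP => -[/eqP-> /eqP]; apply: sp_neq sp n.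
Qed.

(** The neighbors in [E n] and in [F n] together are those in the class that split, and their total
    number is the same for [x] and [y], whose balls both restrict to [S n]. More of the former thus
    means fewer of the latter. *)
Lemma sp_moreF S E F C n x y : splitting phi S E F C ->
  lev n.+2 x = E n.+1 -> lev n.+2 y = F n.+1 -> lcount n.+1 x (F n) < lcount n.+1 y (F n).
Proof.
move=> sp xE yF; have := sp_moreE sp xE yF.
have xy : lev n.+1 x = lev n.+1 y by rewrite (lev_E sp xE) (lev_F sp yF).
have := lcount_lev (class_pred S n) xy; rewrite !(lcount_split _ _ sp) => h lt.
by rewrite -(ltn_add2l (lcount n.+1 x (E n))) h ltn_add2r.
Qed.

(** Thanks to [sp_moreF], whatever follows from a splitting holds with [E] and [F] exchanged. *)
Lemma splitting_sym S E F C : splitting phi S E F C -> splitting phi S F E C.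
Proof.
move=> sp; split=> [n x /(sp_cases sp)[]| | | |n|n x y xF yE|].
- by right.
- by left.
- exact: sp_keep sp.
- exact: sp_F sp.
- exact: sp_E sp.
- exact/nesym/(sp_neq sp).
- exact: (sp_moreF sp).
- exact: sp_center sp.
Qed.

(** As a set of centers, [E n] is a proper nonempty part of a class of the preceding level, so it is
    no class of that level. *)
Lemma lev_neqE S E F C n x : splitting phi S E F C -> lev n x <> E n.
Proof.
move=> sp xE; have [y yS yE] := sp_E sp n; have [z zS zF] := sp_F sp n.
have yx : lev n y = lev n x by apply/lev_mem; rewrite xE -yE; apply/lev_mem.
by apply: (sp_neq sp (n := n)); rewrite -zF -yE; apply/esym/lev_mem; rewrite yE -xE -yx;
   apply/lev_mem; rewrite yS.
Qed.

Lemma lev_neqF S E F C n x : splitting phi S E F C -> lev n x <> F n.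
Proof. by move=> /splitting_sym /lev_neqE. Qed.

Lemma lev_neq_pred S E F C n x : splitting phi S E F C -> lev n.+1 x <> class_pred S n.
Proof.
move=> sp xS; have [y yS _] := sp_E sp n.
have [h|/(sp_keep sp)] := pselect (lev n x = class_pred S n).
  by have [] := sp_cases sp h; rewrite xS -yS; [apply: lev_neqE sp|apply: lev_neqF sp].
by rewrite xS => /esym h; have [] := sp_cases sp h; rewrite xS -yS;
   [apply: lev_neqE sp|apply: lev_neqF sp].
Qed.

Lemma lev_special S E F C n : splitting phi S E F C -> exists x, lev n.+1 x = S n.
Proof. by move=> sp; have [x xS _] := sp_E sp n.+1; exists x. Qed.

Lemma special0 S E F C : splitting phi S E F C -> S 0 = E 0 \/ S 0 = F 0.
Proof. by move=> sp; have [x <-] := lev_special 0 sp; apply: (sp_cases sp). Qed.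

Lemma lcount_keep S E F C n x Y : splitting phi S E F C ->
  Y <> E n -> Y <> F n -> Y <> class_pred S n -> lcount n.+1 x Y = lcount n x Y.
Proof.
move=> sp YE YF YS; apply: eq_count => y /=.
have [h|/(sp_keep sp)->//] := pselect (lev n y = class_pred S n).
rewrite h; transitivity false; last by apply/esym/eqP => /esym.
by apply/eqP; have [->|->] := sp_cases sp h => /esym.
Qed.

(** Such a [Y] was already a class one level below, or is the class that has just split and has no
    ball left. So its count needs one radius less than expected. In particular it is the same for
    all balls of class [S n]. *)
Lemma lcount_const S E F C n x y Y : splitting phi S E F C ->
  Y <> E n -> Y <> F n -> lev n.+1 x = lev n.+1 y -> lcount n.+1 x Y = lcount n.+1 y Y.
Proof.
move=> sp YE YF xy; have [->|YS] := pselect (Y = class_pred S n).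
  by rewrite /lcount !(eq_count (a2 := pred0)) ?count_pred0 // => z; apply/eqP;
     apply: lev_neq_pred sp.
by rewrite !(lcount_keep _ sp) //; apply: lcount_lev.
Qed.

(** The strict inequality [sp_moreE] makes the larger count positive. *)
Lemma adj_SE S E F C n : splitting phi S E F C -> adj n (S n) (E n).
Proof.
move=> sp; have [x xS xE] := sp_E sp n.+1; have [y yS yF] := sp_F sp n.+1.
by rewrite -[S n]xS; apply/class_adj_lcount/(leq_ltn_trans _ (sp_moreE sp xE yF)).
Qed.

Lemma adj_SF S E F C n : splitting phi S E F C -> adj n (S n) (F n).
Proof. by move=> /splitting_sym/adj_SE. Qed.

Definition avoiding n Z X Y : nat := adj n X Y && (Y != Z).

(* By [evert_pred], the vertices of G^E_(n-1), up to the renaming of S_(n-1) as E_n. *)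
Definition side E F n := reachable (avoiding n (F n)) (E n).

Hypothesis phi_acyclic : acyclic_coloring phi.

(* Otherwise a path from X to Y avoiding Z would close up to a cycle through Z. *)
Lemma no_detour n X Y Z : reachable (avoiding n Z) X Y -> X <> Z ->
  adj n X Z -> adj n Y Z -> Y = X.
Proof.
move=> /reachable_path[p0 pp0 lp0] XZ aXZ aYZ; apply: contrapT => YX.
move: lp0; case/shortenP: pp0 => p pp up _ lp.
have /andP[pa pZ] : path (adj n) X p && (Z \notin p).
  elim: p X pp {up lp XZ aXZ YX} => //= V p IHp X; rewrite /avoiding lt0b -andbA.
  move=> /and3P[XV VZ /IHp /andP[-> Zp]]; rewrite XV inE negb_or Zp andbT.
  by rewrite eq_sym VZ.
apply: (phi_acyclic (n := n) (s := Z :: X :: p)).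
  by case: p lp {pp up pa pZ} => //= /esym.
rewrite /ucycle /cycle /= rcons_path lp aYZ pa class_adj_sym aXZ /=.
by move: up; rewrite /= inE negb_or pZ eq_sym => ->; rewrite !andbT; apply/eqP.
Qed.

Lemma no_triangle n X Y Z : X <> Z -> Y <> Z -> adj n X Y -> adj n Y Z -> adj n X Z -> Y = X.
Proof.
move=> XZ YZ XY aYZ aXZ; apply: (@no_detour n X Y Z) => //.
by apply: reachable_step; rewrite lt0b XY; apply/eqP.
Qed.

(** Otherwise [Y], [X], [Y'], [Z] would form a cycle: the path from [Y] to [Y'] through [X] avoids
    [Z]. *)
Lemma common_nbr n X Y Y' Z : X <> Z -> Y <> Z -> Y' <> Z ->
  adj n Y X -> adj n Y Z -> adj n Y' X -> adj n Y' Z -> Y' = Y.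
Proof.
move=> XZ YZ Y'Z YX aYZ Y'X aY'Z; apply: (@no_detour n Y Y' Z) => //.
apply: (@reach_step _ _ _ X); last by rewrite lt0b class_adj_sym Y'X; apply/eqP.
by apply: reachable_step; rewrite lt0b YX; apply/eqP.
Qed.

Lemma center_keep S E F C n : splitting phi S E F C ->
  S n.+1 <> E n.+1 -> S n.+1 <> F n.+1 -> C n = S n.+1 /\ C n <> S n.
Proof.
move=> sp SE SF; have [x xS xC] := sp_center sp n.
have CS : lev n.+1 x <> S n.
  by move=> /(sp_cases sp)[]; rewrite xS.
by rewrite -xC -xS (sp_keep sp CS).
Qed.

Lemma center_special S E F C n : splitting phi S E F C ->
  S n.+1 = E n.+1 \/ S n.+1 = F n.+1 -> C n = S n.
Proof.
move=> sp SEF; have [x xS <-] := sp_center sp n.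
by case: SEF xS => ->; [apply: lev_E sp|apply: lev_E (splitting_sym sp)].
Qed.

(** The class [S n.+1] is adjacent to [E n.+1] and [F n.+1]. If it is one of them, the class of [x]
    closes a triangle. Otherwise two classes have these two common neighbors, so they coincide, and
    [S n.+1] is [C n] by [center_keep]. *)
Lemma adj_both_center S E F C n x : splitting phi S E F C ->
  lev n.+1 x <> S n -> adj n.+1 (lev n.+1 x) (E n.+1) -> adj n.+1 (lev n.+1 x) (F n.+1) ->
  lev n.+1 x = C n.
Proof.
move=> sp xS xE xF; have xnE := @lev_neqE S E F C n.+1 x sp.
have xnF := @lev_neqF S E F C n.+1 x sp; have EF := sp_neq sp (n := n.+1).
have aE := adj_SE n.+1 sp; have aF := adj_SF n.+1 sp.
have [SE|SE] := pselect (S n.+1 = E n.+1).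
  rewrite SE in aF; case: xnE; apply: (no_triangle EF xnF _ xF aF).
  by rewrite class_adj_sym.
have [SF|SF] := pselect (S n.+1 = F n.+1).
  rewrite SF class_adj_sym in aE; case: xnE; apply: (no_triangle EF xnF _ xF aE).
  by rewrite class_adj_sym.
have [-> _] := center_keep sp SE SF.
exact: (common_nbr EF SF xnF aE aF xE xF).
Qed.

Lemma adj_lift S E F C n x X : splitting phi S E F C -> X <> S n ->
  0 < lcount n.+1 x X -> adj n.+1 X (lev n.+2 x).
Proof.
rewrite lcount_gt0 => sp XS /hasP[y xy /eqP yX].
have -> : X = lev n.+2 y by rewrite (sp_keep sp) yX.
by apply: class_adj_nbr; rewrite rt_sym.
Qed.

(** By [lcount_const], all balls of class [S n] have the same number of neighbors in [X]. Hence
    after the splitting [X] is adjacent to both halves, and [adj_both_center] applies. *)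
Lemma other_nbr_center S E F C n X : splitting phi S E F C ->
  adj n (S n) X -> X <> E n -> X <> F n -> X <> S n -> X = C n.
Proof.
move=> sp SX XE XF XS; have [s sS sX] := class_adj_lcountP SX.
have [x xS xE] := sp_E sp n.+1; have [y yS yF] := sp_F sp n.+1.
have [_ [z [_ _ zX]]] := class_adjP SX.
rewrite -zX; apply: (adj_both_center sp); rewrite zX //.
  rewrite -xE; apply: (adj_lift sp) => //.
  by rewrite (@lcount_const _ _ _ _ n x s _ sp) // [LHS]xS sS.
rewrite -yF; apply: (adj_lift sp) => //.
by rewrite (@lcount_const _ _ _ _ n y s _ sp) // [LHS]yS sS.
Qed.

(** The class [F n] survives the splitting of [S n]. It is adjacent to [E n.+1] by hypothesis and to
    [F n.+1] by [sp_moreF], so [adj_both_center] applies. *)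
Lemma F_nbr_center S E F C n x : splitting phi S E F C -> F n <> S n ->
  lev n.+2 x = E n.+1 -> 0 < lcount n.+1 x (F n) -> F n = C n.
Proof.
move=> sp FS xE xF; have [y yS yF] := sp_F sp n.+1; have [z zS zF] := sp_F sp n.
rewrite -zF; apply: (adj_both_center sp); rewrite zF //.
  by rewrite -xE; apply: (adj_lift sp).
by rewrite -yF; apply: (adj_lift sp) => //; apply: leq_ltn_trans (sp_moreF sp xE yF).
Qed.

(* Going down from n, the special class keeps its name and stays a leaf. *)
Lemma leaf_special S E F C n : splitting phi S E F C -> S n = E n ->
  (forall X, adj n (S n) X -> X = E n \/ X = F n) ->
  forall m, m < n -> S m = E m /\ E m = C m.
Proof.
move=> sp; elim: n => [//|n IHn] SE leaf.
have CS : C n = S n by apply: (center_special sp); left.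
have [x xS xE] := sp_E sp n.+1; have [y yS yF] := sp_F sp n.+1.
have xgt : 0 < lcount n.+1 x (E n) by apply: leq_ltn_trans (sp_moreE sp xE yF).
(* Otherwise [E n] survives as a neighbor of [E n.+1], that is, of the leaf [S n.+1], although it is
   neither [E n.+1] nor [F n.+1]. *)
have SnE : S n = E n.
  apply: contrapT => /nesym ES; have := adj_lift sp ES xgt.
  have [z zS zE] := sp_E sp n.
  rewrite xE -SE class_adj_sym => /leaf; rewrite -zE.
  by case; [apply: lev_neqE sp|apply: lev_neqF sp].
have leafn X : adj n (S n) X -> X = E n \/ X = F n.
  move=> SX; apply: contrapT => /not_orP[XE XF]; apply: (XE).
  by rewrite -SnE -CS; apply: (other_nbr_center sp) => //; rewrite SnE.
move=> m; rewrite ltnS leq_eqVlt => /predU1P[->|]; last exact: IHn.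
by rewrite CS SnE.
Qed.

(** Here [C n = S n]. Such an [X] is an old class other than [S n] and adjacent to it. If it were
    not [E n], it would be [C n] by [F_nbr_center] or [other_nbr_center], which is absurd. This
    bounds the neighbors of [E n.+1], making it an end vertex. *)
Lemma nbr_E_center S E F C n X : splitting phi S E F C ->
  S n.+1 = E n.+1 \/ S n.+1 = F n.+1 -> adj n.+1 (E n.+1) X ->
  X <> E n.+1 -> X <> F n.+1 -> X = E n.
Proof.
move=> sp /(center_special sp) CS EX XE XF.
have [x xE xX] := class_adj_lcountP EX; have [_ [y [_ _ yX]]] := class_adjP EX.
have yX1 : lev n.+1 y <> S n by move=> /(sp_cases sp); rewrite yX => -[].
have yX' : lev n.+1 y = X by rewrite -yX (sp_keep sp yX1).
have XS : X <> S n by rewrite -yX'.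
have xX' : 0 < lcount n.+1 x X by rewrite -(@lcount_keep _ _ _ _ n.+1 x X sp).
have xS : lev n.+1 x = S n by apply: lev_E sp xE.
apply: contrapT => XnE; apply: XS; rewrite -CS.
have [XnF|XnF] := pselect (X = F n).
  by rewrite XnF; apply: (F_nbr_center sp _ xE); rewrite -XnF // -yX'.
by apply: (other_nbr_center sp) => //; rewrite -?yX' // -xS; apply: class_adj_lcount; rewrite yX'.
Qed.

End Splitting.

(** The passage from the empty ball to radius 0 counts as the first splitting. At the later ones,
    [sturmian_extension], applied to the two extensions of the special class, shows that every other
    class keeps its set of centers. *)
Lemma splitting_of_naming (d : nat) (T : regular_tree d) (phi : T -> color)
    (S A B C : nat -> set T) :
  sturmian phi -> naming phi S A B C -> splitting phi S A B C.
Proof.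
move=> st nm.
have mem n (x : T) X : lev phi n x = X -> X x by move=> <-; apply/lev_mem.
have lev1 (x : T) : lev phi 1 x = [set y | phi y = phi x].
  apply/seteqP; split=> y /=; first by move=> /bclassE /bclass0.
  by move=> /esym/bclass0/bclassE.
have specialA n : exists2 x, lev phi n.+1 x = S n & lev phi n.+2 x = A n.+1.
  by have [|x [-> ->]] := (nm_special nm n (A n.+1)).2; [left|exists x].
have specialB n : exists2 x, lev phi n.+1 x = S n & lev phi n.+2 x = B n.+1.
  by have [|x [-> ->]] := (nm_special nm n (B n.+1)).2; [right|exists x].
split.
- move=> [|n] x.
    by move=> _; rewrite lev1 (nm_A0 nm) (nm_B0 nm); case: (phi x); [left|right].
  by move=> xS; apply/(nm_special nm n); exists x.
- move=> [|n] x xS; first by case: xS.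
  have [x1 x1S x1A] := specialA n; have [x2 x2S x2B] := specialB n.
  apply/seteqP; split=> y /bclassE; first by move=> /bclass_restrict xy; apply/bclassE.
  move=> xy; apply/bclassE/esym; apply: (sturmian_extension st (x1 := x1) (x2 := x2) (S := x1)).
  + by [].
  + exact: etrans x2S (esym x1S).
  + by rewrite [LHS]x1A [RHS]x2B; apply: nm_distinct nm n.
  + by move=> h; apply: xS; apply: etrans x1S.
  + by [].
- move=> [|n]; last by have [x] := specialA n; exists x.
  by have [x xS _] := specialA 0; exists x => //; rewrite xS (nm_S0 nm).
- move=> [|n]; last by have [x] := specialB n; exists x.
  (* Both colors occur because there are two classes of balls of radius 0. *)
  have [[x xb]|nb] := pselect (exists x, phi x = col_b).
    by exists x => //; rewrite lev1 xb (nm_B0 nm).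
  have eqc (x y : T) : phi x = phi y.
    by case xc: (phi x); case yc: (phi y) => //; case: nb; [exists y|exists x].
  have [s [us ss sP]] := card_eq_seq (st 0).
  case: s us ss sP => [|X [|Y s]] //= /andP[+ _] _ sP.
  have /sP[x _ <-] : X \in [:: X, Y & s] by rewrite mem_head.
  have /sP[y _ <-] : Y \in [:: X, Y & s] by rewrite !inE eqxx orbT.
  by rewrite (bclass0 phi x y).1 // mem_head.
- move=> [|n]; last exact: nm_distinct nm n.
  have [x xS _] := specialA 0; rewrite (nm_S0 nm) in xS.
  move=> AB; move: (mem _ _ _ xS) (mem _ _ _ xS); rewrite {2}AB (nm_A0 nm) (nm_B0 nm) /=.
  by move=> ->.
- by move=> n x y xA yB; apply: (nm_more nm); apply: mem; eassumption.
- by move=> n; have [x [xS xC]] := nm_center nm n; exists x.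
Qed.

(** * Edge-indexed graphs of the classes *)

(** Out of a concatenation, whose vertices form a sum type, a map is easily defined by cases; its
    inverse is obtained by choice, with [w0] as default value outside the graph. *)
Lemma eisom_of_inverse (V W : eqType) (G : eigraph V) (H : eigraph W) (h : W -> V) (w0 : W) :
  set_bij (evert H) (evert G) h ->
  (forall z z', evert H z -> evert H z' -> eidx G (h z) (h z') = eidx H z z') -> G ≅ H.
Proof.
move=> [hto hinj honto] hidx.
have [g gP] : {g : V -> W & forall v, evert G v -> evert H (g v) /\ h (g v) = v}.
  apply: (@choice V W (fun v w => evert G v -> evert H w /\ h w = v)) => v.
  have [/honto[w Hw wv]|nv] := pselect (evert G v); first by exists w.
  by exists w0.
exists g; split; last first.
  move=> u v Gu Gv; have [Hu hu] := gP u Gu; have [Hv hv] := gP v Gv.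
  by rewrite -hidx // hu hv.
split.
- by move=> v /gP[].
- move=> u v /set_mem Gu /set_mem Gv E.
  by have [_ <-] := gP u Gu; have [_ <-] := gP v Gv; rewrite E.
- move=> w Hw; have Gw := hto _ Hw; exists (h w) => //.
  by have [Hg hg] := gP _ Gw; apply: hinj hg; apply/mem_set.
Qed.

Section Graphs.
Variables (d : nat) (T : regular_tree d) (phi : T -> color).
Hypothesis phi_acyclic : acyclic_coloring phi.
Implicit Types (S E F C : nat -> set T) (X Y Z : set T).

Local Notation lev := (lev phi).
Local Notation lcount := (lcount phi).
Local Notation adj := (class_adj phi).

Lemma class_count_lev n x Y : class_count phi n (lev n.+2 x) Y = lcount n.+1 x Y.
Proof.
apply: xget_unique; first by exists x => //; apply/lev_mem.
by move=> k [y /lev_mem xy ->]; apply: (@lcount_lev _ _ phi n.+1).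
Qed.

(** * Indices read at a representative [x0] of the chosen extension of the special class *)

Section Index.
Variables (S E F C : nat -> set T) (n : nat) (x0 : T).
Hypotheses (sp : splitting phi S E F C) (x0S : lev n.+1 x0 = S n).

Local Notation index := (class_index phi n (S n) (lev n.+2 x0)).

Lemma index_lev x Y : (lev n.+1 x = S n -> lev n.+2 x = lev n.+2 x0) ->
  index (lev n.+1 x) Y = lcount n.+1 x Y.
Proof.
rewrite /class_index; case: eqP => [xS /(_ xS)<-|xS _]; first exact: class_count_lev.
by rewrite -(sp_keep sp (n := n.+1) xS); apply: class_count_lev.
Qed.

Lemma index_special Y : index (S n) Y = lcount n.+1 x0 Y.
Proof. by rewrite -{2}x0S; apply: index_lev. Qed.

Lemma index_regular x Y : lev n.+1 x <> S n -> index (lev n.+1 x) Y = lcount n.+1 x Y.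
Proof. by move=> xS; apply: index_lev. Qed.

Lemma index_rep x : exists2 y, lev n.+1 y = lev n.+1 x &
  (lev n.+1 x = S n -> y = x0) /\ forall Y, index (lev n.+1 x) Y = lcount n.+1 y Y.
Proof.
have [xS|xS] := pselect (lev n.+1 x = S n); last first.
  by exists x => //; split=> [//|Y]; apply: index_regular.
by exists x0; rewrite xS //; split=> // Y; apply: index_special.
Qed.

Lemma index_gt0_adj x Y : 0 < index (lev n.+1 x) Y -> adj n (lev n.+1 x) Y.
Proof. by have [y yx [_ ->]] := index_rep x; rewrite -yx; apply: class_adj_lcount. Qed.

(** An adjacency gives an oriented edge of positive index, except possibly from [S n] to [E n] or
    [F n]: all other counts are constant on the class. *)
Lemma adj_index_gt0 X Y : adj n X Y ->
  (X = S n -> Y = E n -> 0 < lcount n.+1 x0 Y) ->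
  (X = S n -> Y = F n -> 0 < lcount n.+1 x0 Y) -> 0 < index X Y.
Proof.
move=> /class_adj_lcountP[x <- xY] hE hF.
have [xS|xS] := pselect (lev n.+1 x = S n); last by rewrite index_regular.
rewrite xS index_special.
have [YE|YE] := pselect (Y = E n); first exact: hE.
have [YF|YF] := pselect (Y = F n); first exact: hF.
by rewrite (@lcount_const _ _ _ _ _ _ _ n x0 x Y sp) // x0S.
Qed.

End Index.

Lemma side_lev S E F C n X : splitting phi S E F C ->
  side phi E F n X -> X <> F n /\ exists x, lev n.+1 x = X.
Proof.
move=> sp; case=> [|Y {}X _]; last first.
  by rewrite lt0b => /andP[/class_adjP[x [y [_ _ <-]]] /eqP XF]; split=> //; exists y.
by have [x _ xE] := sp_E sp n; split; [apply: sp_neq sp n|exists x].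
Qed.

Lemma side_step E F n X Y :
  side phi E F n X -> adj n X Y -> Y = F n \/ side phi E F n Y.
Proof.
move=> EX XY; have [->|YF] := pselect (Y = F n); [by left|right].
by apply: reach_step EX _; rewrite lt0b XY; apply/eqP.
Qed.

(** Away from [F n] this is the restriction of classes to the preceding radius; only [E n] changes
    its set of centers. *)
Definition coarsen S E n X := if X == E n then class_pred S n else X.
Definition uncoarsen S E n X := if X == class_pred S n then E n else X.

Lemma coarsenK S E F C n x : splitting phi S E F C ->
  uncoarsen S E n (coarsen S E n (lev n.+1 x)) = lev n.+1 x.
Proof.
rewrite /coarsen /uncoarsen => sp; have [->|_] := eqVneq (lev n.+1 x) (E n).
  by rewrite eqxx.
by case: eqP => // /(lev_neq_pred sp).
Qed.

Lemma coarsen_lev S E F C n x : splitting phi S E F C -> lev n.+1 x <> F n ->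
  coarsen S E n (lev n.+1 x) = lev n x.
Proof.
rewrite /coarsen => sp xF; case: eqP => [/(lev_E sp)//|xE].
by apply: (sp_keep sp) => /(sp_cases sp)[].
Qed.

Lemma lcount_coarsen S E F C n x Y : splitting phi S E F C -> (exists y, lev n.+1 y = Y) ->
  Y <> F n -> lcount n x (coarsen S E n Y) =
    lcount n.+1 x Y + (if Y == E n then lcount n.+1 x (F n) else 0).
Proof.
rewrite /coarsen => sp [y <-] YF; case: eqP => [->|YE]; first by rewrite (lcount_split _ _ sp).
by rewrite addn0 (lcount_keep _ sp) //; apply: lev_neq_pred sp.
Qed.

(** * The graph of the preceding radius as one side of the present graph *)

Section Pred.
Variables (S E F C : nat -> set T) (n : nat).
Hypothesis sp : splitting phi S E F C.

Local Notation G' := (class_graph_pred phi S E n).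

(** In the preceding graph the indices at the special class are those of [E n], so its edges can be
    followed from balls outside [F n] only. Restricting or extending the classes along a path
    translates one reachability into the other. *)
Lemma evert_pred Z :
  evert G' Z <-> exists2 X, side phi E F n X & Z = coarsen S E n X.
Proof.
have Eside : side phi E F n (E n) by apply: reach_refl.
have EE m : coarsen S E m (E m) = class_pred S m by rewrite /coarsen eqxx.
case: n Eside => [|m] Eside /=.
  split=> [->|[X /(side_lev sp)[XF [x xX]] ->]]; first by exists (E 0); rewrite ?EE.
  by rewrite -xX (coarsen_lev sp) ?xX.
have [e eS eE] := sp_E sp m.+1.
have inv x : lev m.+2 x <> F m.+1 ->
    lev m.+1 x = S m -> lev m.+2 x = lev m.+2 e.
  by move=> xF /(sp_cases sp (n := m.+1))[]; rewrite eE.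
rewrite -eE; split=> [|[X EX ->]].
  elim=> [|{}Z Z' _ [X EX ->]]; first by exists (E m.+1); rewrite ?EE.
  have [XF [x xX]] := side_lev sp EX; subst X.
  rewrite (coarsen_lev sp XF) (index_lev sp _ (inv x XF)) lcount_gt0 => /hasP[y xy /eqP<-].
  (* A neighbor in [F m.+1] restricts to [S m], which is also the image of [E m.+1]. *)
  have [yF|yF] := pselect (lev m.+2 y = F m.+1).
    by exists (E m.+1); rewrite ?EE //; apply: lev_F sp yF.
  exists (lev m.+2 y); last by rewrite (coarsen_lev sp).
  by have [] := side_step EX (class_adj_nbr phi m.+1 xy).
elim: EX => [|{}X Y EX IHX]; first by rewrite EE; apply: reach_refl.
have [XF _] := side_lev sp EX.
rewrite lt0b => /andP[/class_adjP[x [y [xy xX yY]]] /eqP YF]; subst X Y.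
apply: reach_step IHX _; rewrite !(coarsen_lev sp) // (index_lev sp _ (inv x XF)).
by rewrite lcount_gt0; apply/hasP; exists y.
Qed.

(** Neighbors in [F n] and in [E n] have the same restriction, so the former are added to the index
    towards the vertex that represents [E n]. *)
Lemma eidx_pred x Y : side phi E F n (lev n.+1 x) -> side phi E F n Y ->
  eidx G' (coarsen S E n (lev n.+1 x)) (coarsen S E n Y) =
    lcount n.+1 x Y + (if Y == E n then lcount n.+1 x (F n) else 0).
Proof.
move=> /(side_lev sp)[xF _] /(side_lev sp)[YF Ylev]; rewrite -(lcount_coarsen _ sp) //.
case: Ylev => y yY; subst Y; rewrite !(coarsen_lev sp) //.
case: n xF YF => [|m] xF YF /=.
  by rewrite [lev 0 y](_ : _ = setT) ?lcount0.
have [e eS eE] := sp_E sp m.+1; rewrite -eE; apply: (index_lev sp).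
by move=> /(sp_cases sp (n := m.+1))[]; rewrite eE.
Qed.

Lemma eadj_pred X z : side phi E F n X -> eadj G' (coarsen S E n X) z ->
  exists Y, [/\ side phi E F n Y, z = coarsen S E n Y, Y <> X &
    [\/ adj n X Y, Y = E n /\ adj n X (F n) | X = E n /\ adj n Y (F n)]].
Proof.
move=> EX [/evert_pred[Y EY ->] YX pos]; exists Y; split=> //.
  by move=> E'; apply: YX; rewrite E'.
have [_ [x xX]] := side_lev sp EX; have [_ [y yY]] := side_lev sp EY; subst X Y.
case: pos; rewrite eidx_pred // addn_gt0 => /orP[].
- by move=> /class_adj_lcount; constructor 1.
- by case: eqP => // YE /class_adj_lcount; constructor 2.
- by move=> /class_adj_lcount; rewrite class_adj_sym; constructor 1.
- by case: eqP => // YE /class_adj_lcount; constructor 3.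
Qed.

End Pred.

Lemma class_graphE S W n x0 : W n.+1 = lev n.+2 x0 -> class_graph phi S W n =
  let w := class_index phi n (S n) (lev n.+2 x0) in EIGraph (reachable w (S n)) w.
Proof. by rewrite /class_graph => ->. Qed.

(** * Extent of the present graph: one side, or both *)

Section Concat.
Variables (S E F C W : nat -> set T) (n : nat) (x0 : T).
Hypotheses (sp : splitting phi S E F C) (x0S : lev n.+1 x0 = S n).
Hypothesis x0W : W n.+1 = lev n.+2 x0.

(** By [no_detour], the side of [E n] can be left towards [F n] from [S n] only, and the index of
    that edge is 0. So exactly this side is reached, and no neighbor in [F n] disturbs the
    comparison of indices. *)
Lemma class_graph_isom_pred : S n <> F n -> (S n <> E n -> 0 < lcount n.+1 x0 (E n)) ->
  lcount n.+1 x0 (F n) = 0 ->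
  class_graph phi S W n ≅ class_graph_pred phi S E n.
Proof.
move=> SF posE zeroF; rewrite (class_graphE _ x0W) /=.
set w := class_index _ _ _ _.
have aSE := adj_SE n sp; have aSF := adj_SF n sp.
have Sside : side phi E F n (S n).
  have [] := @side_step E F n (E n) (S n) (reach_refl _ _); rewrite // class_adj_sym //.
have RU X : reachable w (S n) X <-> side phi E F n X.
  split=> [RX|].
    suff : reachable (avoiding phi n (F n)) (S n) X.
      elim=> // Y Z _ EY; rewrite lt0b => /andP[YZ /eqP ZF].
      by have [] := side_step EY YZ.
    elim: RX => [|Y Z _ IH YZ]; first exact: reach_refl.
    have [y yY] : exists y, lev n.+1 y = Y.
      case: (IH) => [|Y0 Y1 _]; first by exists x0.
      by rewrite lt0b => /andP[/class_adjP[a [b [_ _ <-]]] _]; exists b.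
    subst Y; have aYZ := index_gt0_adj sp x0S YZ.
    apply: (reach_step IH); rewrite lt0b aYZ; apply/eqP => ZF; subst Z.
    have YS := no_detour phi_acyclic IH SF aSF aYZ.
    by move: YZ; rewrite /w YS (index_special sp x0S) zeroF.
  have RE : reachable w (S n) (E n).
    have [<-|/posE pos] := pselect (S n = E n); first exact: reach_refl.
    by apply: reachable_step; rewrite /w (index_special sp x0S).
  elim=> [//|{}X Y _ RX]; rewrite lt0b => /andP[XY /eqP YF].
  have [->//|YE] := pselect (Y = E n).
  by apply: reach_step RX _; apply: (adj_index_gt0 sp x0S XY).
exists (coarsen S E n); split.
  split.
  - by move=> X /RU EX; apply/(evert_pred n sp); exists X.
  - move=> X Y /set_mem/RU/(side_lev sp)[_ [x <-]] /set_mem/RU/(side_lev sp)[_ [y <-]].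
    by move=> /(congr1 (uncoarsen S E n)); rewrite !(coarsenK _ _ sp).
  - by move=> Z /(evert_pred n sp)[X EX ->]; exists X => //; apply/RU.
move=> X Y /RU EX RY /=; have [_ [x xX]] := side_lev sp EX; subst X.
have [z zx [_ idx]] := index_rep sp x0S x.
rewrite /w idx -zx (eidx_pred sp) ?zx //; last exact/RU.
suff -> : lcount n.+1 z (F n) = 0 by case: ifP; rewrite addn0.
apply/eqP; rewrite -leqn0 leqNgt -idx; apply/negP => zF.
by have [] : F n <> F n /\ exists x, lev n.+1 x = F n by
  apply: (side_lev sp); apply/RU; apply: reach_step zF; apply/RU.
Qed.

(** A single ball computes the indices at [X] in both graphs. For [X = S n] it must be the one
    around [x0], since the counts there depend on the extension. *)
Lemma side_rep X : side phi E F n X -> exists u, [/\ lev n.+1 u = X, X = S n -> u = x0,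
    forall Z, eidx (class_graph phi S W n) X Z = lcount n.+1 u Z &
    forall Y, side phi E F n Y ->
      eidx (class_graph_pred phi S E n) (coarsen S E n X) (coarsen S E n Y) =
      lcount n.+1 u Y + (if Y == E n then lcount n.+1 u (F n) else 0)].
Proof.
move=> EX; have [_ [v vX]] := side_lev sp EX; subst X.
have [u uv [ux0 idx]] := index_rep sp x0S v; exists u; split=> //.
- by move=> Z; rewrite (class_graphE _ x0W) /= idx.
- by move=> Y EY; rewrite -uv (eidx_pred sp) ?uv.
Qed.

Lemma evert_class_graph X :
  (S n <> E n -> 0 < lcount n.+1 x0 (E n)) -> (S n <> F n -> 0 < lcount n.+1 x0 (F n)) ->
  evert (class_graph phi S W n) X <-> side phi E F n X \/ side phi F E n X.
Proof.
move=> posE posF; rewrite (class_graphE _ x0W) /=; set w := class_index _ _ _ _.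
have RE : reachable w (S n) (E n).
  have [<-|/posE pos] := pselect (S n = E n); first exact: reach_refl.
  by apply: reachable_step; rewrite /w (index_special sp x0S).
have RF : reachable w (S n) (F n).
  have [<-|/posF pos] := pselect (S n = F n); first exact: reach_refl.
  by apply: reachable_step; rewrite /w (index_special sp x0S).
have closed Y Z : reachable w (S n) Y -> adj n Y Z -> reachable w (S n) Z.
  move=> RY YZ; have [->//|ZE] := pselect (Z = E n); have [->//|ZF] := pselect (Z = F n).
  by apply: (reach_step RY); apply: (adj_index_gt0 sp x0S YZ).
have sp' := splitting_sym sp; split=> [|[]]; last 2 first.
- by elim=> // Y Z _ RY; rewrite lt0b => /andP[YZ _]; apply: closed YZ.
- by elim=> // Y Z _ RY; rewrite lt0b => /andP[YZ _]; apply: closed YZ.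
elim=> [|Y Z _ IH YZ].
  have [->|/nesym SE] := pselect (S n = E n); first by left; apply: reach_refl.
  have [] := @side_step F E n (F n) (S n) (reach_refl _ _); [|by move/esym|by right].
  by rewrite class_adj_sym; apply: adj_SF sp.
have [u uY] : exists u, lev n.+1 u = Y.
  by case: IH => [/(side_lev sp)[]|/(side_lev sp')[]].
subst Y; have aYZ := index_gt0_adj sp x0S YZ.
case: IH => EY.
  by have [->|] := side_step EY aYZ; [right; apply: reach_refl|left].
by have [->|] := side_step EY aYZ; [left; apply: reach_refl|right].
Qed.

End Concat.

Lemma coarsen_pred S E F C n x : splitting phi S E F C ->
  (coarsen S E n (lev n.+1 x) == class_pred S n) = (lev n.+1 x == E n).
Proof.
rewrite /coarsen => sp; case: (eqVneq (lev n.+1 x)) => [|_]; first by rewrite eqxx.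
by apply/eqP; apply: lev_neq_pred sp.
Qed.

Lemma lcount_rep S E F C n x y Y : splitting phi S E F C -> lev n.+1 x = lev n.+1 y ->
  (lev n.+1 y = S n -> x = y) -> lcount n.+1 x Y = lcount n.+1 y Y.
Proof.
move=> sp xy h; have [/h->//|yS] := pselect (lev n.+1 y = S n).
by apply: (@lcount_lev _ _ phi n.+1); rewrite !(sp_keep sp (n := n.+1)) ?xy.
Qed.

Lemma lcount_nadj n x Y : ~ adj n (lev n.+1 x) Y -> lcount n.+1 x Y = 0.
Proof.
move=> xY; apply/eqP; rewrite -leqn0 leqNgt; apply/negP.
by move=> /class_adj_lcount.
Qed.

(** * The special class is [E n] or [F n]: the two sides are joined by an edge *)

Section Edge.
Variables (S E F C : nat -> set T) (n : nat).
Hypotheses (sp : splitting phi S E F C) (SEF : S n = E n \/ S n = F n).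

Lemma special_edge : adj n (E n) (F n).
Proof.
case: SEF => SE; first by rewrite -{1}SE; apply: adj_SF sp.
by rewrite class_adj_sym -{1}SE; apply: adj_SE sp.
Qed.

Lemma edge_side_adj X : side phi E F n X -> adj n X (F n) -> X = E n.
Proof. by move=> EX; apply: (no_detour phi_acyclic EX _ special_edge); apply: sp_neq sp n. Qed.

Lemma edge_end_vertex : end_vertex (class_graph_pred phi S E n) (class_pred S n).
Proof.
have EE : class_pred S n = coarsen S E n (E n) by rewrite /coarsen eqxx.
have sideE : side phi E F n (E n) by apply: reach_refl.
split; first by apply/(evert_pred n sp); exists (E n).
have nbrE z : eadj (class_graph_pred phi S E n) (class_pred S n) z ->
    exists X, [/\ z = coarsen S E n X, adj n (E n) X, X <> E n & X <> F n].
  rewrite {1}EE => /(eadj_pred sp sideE)[X [EX -> XE h]]; exists X.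
  have [XF _] := side_lev sp EX; split=> //.
  by case: h => [//|[/XE]|[_ /(edge_side_adj EX)/XE]].
move=> z z' /nbrE[X [-> EX XE XF]] /nbrE[X' [-> EX' XE' XF']].
(* For [n = 0] the only classes are [E 0] and [F 0], so the end vertex has no neighbor. *)
case: n SEF sp EX EX' XE XE' XF XF' => [|m] SEF' _ EX EX' XE XE' XF XF'.
  have [_ [x [_ _ xX]]] := class_adjP EX; have [] // := sp_cases sp (n := 0) (x := x) _.
    by rewrite xX.
  by rewrite xX.
by rewrite (nbr_E_center phi_acyclic sp SEF' EX) // (nbr_E_center phi_acyclic sp SEF' EX').
Qed.

End Edge.

(** A path from [F n] that avoids [E n] cannot enter the side of [E n], because [E n] is the only
    class of that side adjacent to [F n]. *)
Lemma edge_sides_disjoint S E F C n X : splitting phi S E F C -> S n = E n \/ S n = F n ->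
  side phi F E n X -> ~ side phi E F n X.
Proof.
move=> sp SEF; elim=> [/(side_lev sp)[]//|Y Z FY nEY].
rewrite lt0b => /andP[YZ /eqP ZE] EZ; rewrite class_adj_sym in YZ.
have [YF|//] := side_step EZ YZ; subst Y.
by apply: ZE; apply: (edge_side_adj sp SEF EZ YZ).
Qed.

(** The new edge joins [E n] and [F n], and its indices are the counts at the representatives [x]
    and [y]. The one whose class is [S n] must be [x0]; at the other class the count does not depend
    on the representative. *)
Lemma class_graph_concat2 S E F C W n x0 x y : splitting phi S E F C ->
  S n = E n \/ S n = F n -> class_pred C n = class_pred S n ->
  lev n.+1 x0 = S n -> W n.+1 = lev n.+2 x0 ->
  (S n <> E n -> 0 < lcount n.+1 x0 (E n)) -> (S n <> F n -> 0 < lcount n.+1 x0 (F n)) ->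
  lev n.+1 x = E n -> (S n = E n -> x = x0) -> lev n.+1 y = F n -> (S n = F n -> y = x0) ->
  isom_concat2 (class_graph phi S W n)
    (class_graph_pred phi S E n) (class_pred C n) (class_graph_pred phi S F n) (class_pred C n)
    (lcount n.+1 x (F n)) (lcount n.+1 y (E n)).
Proof.
move=> sp SEF -> x0S x0W posE posF xE xx0 yF yy0.
have sp' := splitting_sym sp; have SFE : S n = F n \/ S n = E n by case: SEF; [right|left].
have cE : coarsen S E n (lev n.+1 x) = class_pred S n by rewrite xE /coarsen eqxx.
have cF : coarsen S F n (lev n.+1 y) = class_pred S n by rewrite yF /coarsen eqxx.
have sE : side phi E F n (lev n.+1 x) by rewrite xE; apply: reach_refl.
have sF : side phi F E n (lev n.+1 y) by rewrite yF; apply: reach_refl.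
have aEF := special_edge sp SEF.
have full X := evert_class_graph sp x0S x0W X posE posF.
have xpos : 0 < lcount n.+1 x (F n).
  have [z zE zF] := class_adj_lcountP aEF.
  have [SE|SE] := pselect (S n = E n); last first.
    by rewrite (@lcount_rep _ _ _ _ n x z _ sp) ?zE ?xE // => /esym.
  by rewrite (xx0 SE); apply: posF; rewrite SE; apply: sp_neq sp n.
have ypos : 0 < lcount n.+1 y (E n).
  rewrite class_adj_sym in aEF; have [z zE zF] := class_adj_lcountP aEF.
  have [SF|SF] := pselect (S n = F n); last first.
    by rewrite (@lcount_rep _ _ _ _ n y z _ sp) ?zE ?yF // => /esym.
  by rewrite (yy0 SF); apply: posE; rewrite SF; apply: nesym; apply: sp_neq sp n.
have lE u : lev n.+1 u = E n -> (lev n.+1 u = S n -> u = x0) ->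
    lcount n.+1 u (F n) = lcount n.+1 x (F n).
  by move=> uE ux0; apply: (lcount_rep _ sp); rewrite ?uE ?xE // => ES; rewrite ux0 ?uE // xx0.
have lF u : lev n.+1 u = F n -> (lev n.+1 u = S n -> u = x0) ->
    lcount n.+1 u (E n) = lcount n.+1 y (E n).
  by move=> uF ux0; apply: (lcount_rep _ sp); rewrite ?uF ?yF // => FS; rewrite ux0 ?uF // yy0.
have disj X : side phi E F n X -> ~ side phi F E n X by move=> EX /(edge_sides_disjoint sp SEF).
have idxSE : lcount n.+1 x (F n) <=
    eidx (class_graph_pred phi S E n) (class_pred S n) (class_pred S n).
  by rewrite -{1}cE -cE (eidx_pred sp) // xE eqxx leq_addl.
have idxSF : lcount n.+1 y (E n) <=
    eidx (class_graph_pred phi S F n) (class_pred S n) (class_pred S n).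
  by rewrite -{1}cF -cF (eidx_pred sp') // yF eqxx leq_addl.
split; rewrite ?xpos ?ypos //.
  by split; [apply: (edge_end_vertex sp)|apply: (edge_end_vertex sp')].
pose h (z : set T + set T) :=
  match z with inl D => uncoarsen S E n D | inr D => uncoarsen S F n D end.
apply: (@eisom_of_inverse _ _ _ _ h (inl (E n))).
  split.
  - move=> [Z|Z] /=.
      move=> /(evert_pred n sp)[X EX ->]; have [_ [u uX]] := side_lev sp EX; subst X.
      by rewrite (coarsenK _ _ sp); apply/full; left.
    move=> /(evert_pred n sp')[X EX ->]; have [_ [u uX]] := side_lev sp' EX; subst X.
    by rewrite (coarsenK _ _ sp'); apply/full; right.
  - move=> [Z|Z] [Z'|Z'] /set_mem + /set_mem /=.
    + move=> /(evert_pred n sp)[X EX ->] /(evert_pred n sp)[X' EX' ->].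
      have [_ [u uX]] := side_lev sp EX; have [_ [u' uX']] := side_lev sp EX'; subst X X'.
      by rewrite !(coarsenK _ _ sp) => ->.
    + move=> /(evert_pred n sp)[X EX ->] /(evert_pred n sp')[X' EX' ->].
      have [_ [u uX]] := side_lev sp EX; have [_ [u' uX']] := side_lev sp' EX'; subst X X'.
      by rewrite (coarsenK _ _ sp) (coarsenK _ _ sp') => uu; case: (disj _ EX); rewrite uu.
    + move=> /(evert_pred n sp')[X EX ->] /(evert_pred n sp)[X' EX' ->].
      have [_ [u uX]] := side_lev sp' EX; have [_ [u' uX']] := side_lev sp EX'; subst X X'.
      by rewrite (coarsenK _ _ sp) (coarsenK _ _ sp') => uu; case: (disj _ EX'); rewrite -uu.
    + move=> /(evert_pred n sp')[X EX ->] /(evert_pred n sp')[X' EX' ->].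
      have [_ [u uX]] := side_lev sp' EX; have [_ [u' uX']] := side_lev sp' EX'; subst X X'.
      by rewrite !(coarsenK _ _ sp') => ->.
  - move=> X /full[] EX.
      have [_ [u uX]] := side_lev sp EX; subst X; exists (inl (coarsen S E n (lev n.+1 u))).
        by apply/(evert_pred n sp); exists (lev n.+1 u).
      exact: (coarsenK _ _ sp).
    have [_ [u uX]] := side_lev sp' EX; subst X; exists (inr (coarsen S F n (lev n.+1 u))).
      by apply/(evert_pred n sp'); exists (lev n.+1 u).
    exact: (coarsenK _ _ sp').
move=> [Z|Z] [Z'|Z'] /=.
- move=> /(evert_pred n sp)[X EX ->] /(evert_pred n sp)[X' EX' ->].
  have [u [uX ux0 idx /(_ _ EX') ->]] := side_rep sp x0S x0W EX.
  have [_ [u' uX']] := side_lev sp EX'; subst X X'.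
  rewrite !(coarsenK _ _ sp) !(coarsen_pred _ _ sp) [LHS]idx.
  have [u'E|_] := eqVneq (lev n.+1 u') (E n); last by rewrite andbF addn0.
  have [uE|/eqP uE] := eqVneq (lev n.+1 u) (E n) => /=; last first.
    rewrite (@lcount_nadj n u (F n)) ?addn0 // => uF'.
    by apply: uE; apply: (edge_side_adj sp SEF EX uF').
  (* The old loop counts the neighbors in [E n] and in [F n]; removing the index of the new edge
     leaves those in [E n]. *)
  by rewrite -{1}cE -cE xE -uE (eidx_pred sp) // uE eqxx lE // addnK u'E.
- move=> /(evert_pred n sp)[X EX ->] /(evert_pred n sp')[X' EX' ->].
  have [u [uX ux0 idx _]] := side_rep sp x0S x0W EX.
  have [_ [u' uX']] := side_lev sp' EX'; subst X X'.
  rewrite (coarsenK _ _ sp) (coarsenK _ _ sp') (coarsen_pred _ _ sp) (coarsen_pred _ _ sp').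
  rewrite [LHS]idx; case: ifP => [/andP[/eqP uE /eqP ->]|uu']; first exact: lE.
  apply: lcount_nadj => auu'; move/negP: uu'; apply; apply/andP.
  have u'F : lev n.+1 u' = F n.
    by have [//|Eu'] := side_step EX auu'; case: (disj _ Eu').
  by split; apply/eqP => //; apply: (edge_side_adj sp SEF EX); rewrite -u'F.
- move=> /(evert_pred n sp')[X EX ->] /(evert_pred n sp)[X' EX' ->].
  have [u [uX ux0 idx _]] := side_rep sp' x0S x0W EX.
  have [_ [u' uX']] := side_lev sp EX'; subst X X'.
  rewrite (coarsenK _ _ sp) (coarsenK _ _ sp') (coarsen_pred _ _ sp) (coarsen_pred _ _ sp').
  rewrite [LHS]idx; case: ifP => [/andP[/eqP uE /eqP ->]|uu']; first exact: lF.
  apply: lcount_nadj => auu'; move/negP: uu'; apply; apply/andP.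
  have u'E : lev n.+1 u' = E n.
    by have [//|Eu'] := side_step EX auu'; case: (disj _ EX').
  by split; apply/eqP => //; apply: (edge_side_adj sp' SFE EX); rewrite -u'E.
- move=> /(evert_pred n sp')[X EX ->] /(evert_pred n sp')[X' EX' ->].
  have [u [uX ux0 idx /(_ _ EX') ->]] := side_rep sp' x0S x0W EX.
  have [_ [u' uX']] := side_lev sp' EX'; subst X X'.
  rewrite !(coarsenK _ _ sp') !(coarsen_pred _ _ sp') [LHS]idx.
  have [u'E|_] := eqVneq (lev n.+1 u') (F n); last by rewrite andbF addn0.
  have [uE|/eqP uE] := eqVneq (lev n.+1 u) (F n) => /=; last first.
    rewrite (@lcount_nadj n u (E n)) ?addn0 // => uF'.
    by apply: uE; apply: (edge_side_adj sp' SFE EX uF').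
  by rewrite -{1}cF -cF yF -uE (eidx_pred sp') // uE eqxx lF // addnK u'E.
Qed.

(** * The special class is neither [E n] nor [F n]: the two sides share it *)

Section Middle.
Variables (S E F C : nat -> set T) (n : nat).
Hypotheses (sp : splitting phi S E F C) (SE : S n <> E n) (SF : S n <> F n).

Lemma coarsen_special : coarsen S E n (S n) = S n.
Proof. by rewrite /coarsen; case: eqP. Qed.

Lemma special_neq_pred : S n <> class_pred S n.
Proof. by have [x <-] := lev_special n sp; apply: lev_neq_pred sp. Qed.

Lemma coarsen_eq_special X : (coarsen S E n X == S n) = (X == S n).
Proof.
rewrite /coarsen; have [->|//] := eqVneq X (E n).
by apply/eqP/eqP => /esym; [move/special_neq_pred|move/SE].
Qed.

Lemma middle_side_special : side phi E F n (S n).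
Proof.
have [] := @side_step E F n (E n) (S n) (reach_refl _ _); rewrite // class_adj_sym.
exact: adj_SE sp.
Qed.

(** A path from [S n] to [X] through [E n] avoids [F n], and [S n] is adjacent to [F n], so
    [no_detour] applies. *)
Lemma middle_side_adj X : side phi E F n X -> X <> S n -> ~ adj n X (F n).
Proof.
move=> EX XS XF; apply: XS.
apply: (no_detour phi_acyclic _ SF (adj_SF n sp) XF).
elim: EX => [|Y Z _]; last exact: reach_step.
by apply: reachable_step; rewrite lt0b (adj_SE n sp); apply/eqP/(sp_neq sp).
Qed.

Hypothesis leaf : forall X, adj n (S n) X -> [\/ X = E n, X = F n | X = S n].

Lemma middle_sides_disjoint X : side phi F E n X -> X <> S n -> ~ side phi E F n X.
Proof.
elim=> [_ /(side_lev sp)[]//|Y Z FY IH].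
rewrite lt0b => /andP[YZ /eqP ZE] ZS EZ.
have [YS|YS] := pselect (Y = S n).
  by move: YZ; rewrite YS => /leaf[//|ZF|//]; have [/(_ ZF)] := side_lev sp EZ.
rewrite class_adj_sym in YZ; have [YF|] := side_step EZ YZ; last exact: IH.
by subst Y; apply: middle_side_adj EZ ZS YZ.
Qed.

Lemma eadj_middle z : eadj (class_graph_pred phi S E n) (S n) z -> z = class_pred S n.
Proof.
rewrite -{1}coarsen_special => /(eadj_pred sp middle_side_special)[X [EX -> XS h]].
suff -> : X = E n by rewrite /coarsen eqxx.
have [XF _] := side_lev sp EX; case: h => [/leaf[]//|[]//|[/SE]//].
Qed.

Lemma middle_end_vertex : end_vertex (class_graph_pred phi S E n) (S n).
Proof.
split; last by move=> z z' /eadj_middle-> /eadj_middle.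
apply/(evert_pred n sp); exists (S n); rewrite ?coarsen_special //.
exact: middle_side_special.
Qed.

(** This value is symmetric in [E] and [F], so the non-loop edges at the two end vertices have a
    common index. *)
Lemma eidx_middle_pred x : lev n.+1 x = S n ->
  eidx (class_graph_pred phi S E n) (S n) (class_pred S n) =
    lcount n.+1 x (E n) + lcount n.+1 x (F n).
Proof.
move=> xS; have EE : class_pred S n = coarsen S E n (E n) by rewrite /coarsen eqxx.
have Ss := middle_side_special; rewrite -xS in Ss.
by have := eidx_pred sp Ss (reach_refl _ _); rewrite xS coarsen_special -EE eqxx.
Qed.

Lemma eidx_middle_loop x : lev n.+1 x = S n ->
  eidx (class_graph_pred phi S E n) (S n) (S n) = lcount n.+1 x (S n).
Proof.
move=> xS; have Ss := middle_side_special; rewrite -xS in Ss.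
have := eidx_pred sp Ss Ss; rewrite xS coarsen_special => ->.
by case: eqP => [/SE//|_]; rewrite addn0.
Qed.

Lemma middle_end_index x : lev n.+1 x = S n ->
  0 < lcount n.+1 x (E n) + lcount n.+1 x (F n) ->
  end_index (class_graph_pred phi S E n) (S n) (lcount n.+1 x (E n) + lcount n.+1 x (F n)).
Proof.
move=> xS pos; left; exists (class_pred S n); last by rewrite (eidx_middle_pred xS).
split; [|exact/nesym/special_neq_pred|by left; rewrite (eidx_middle_pred xS)].
by apply/(evert_pred n sp); exists (E n); rewrite /coarsen ?eqxx //; apply: reach_refl.
Qed.

End Middle.

(** The common index [m] counts the neighbors of [x0] in [E n] or [F n]; after gluing it is shared
    between the two sides, the part [i] being the number of those in [E n]. *)
Lemma class_graph_concat1 S E F C W n x0 : splitting phi S E F C ->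
  S n <> E n -> S n <> F n -> (forall X, adj n (S n) X -> [\/ X = E n, X = F n | X = S n]) ->
  class_pred C n = S n -> lev n.+1 x0 = S n -> W n.+1 = lev n.+2 x0 ->
  0 < lcount n.+1 x0 (E n) -> 0 < lcount n.+1 x0 (F n) ->
  isom_concat1 (class_graph phi S W n)
    (class_graph_pred phi S E n) (class_pred C n) (class_graph_pred phi S F n) (class_pred C n)
    (lcount n.+1 x0 (E n)).
Proof.
move=> sp SE SF leaf -> x0S x0W posE posF.
have sp' := splitting_sym sp.
have leaf' X : adj n (S n) X -> [\/ X = F n, X = E n | X = S n].
  by move=> /leaf[]; [constructor 2|constructor 1|constructor 3].
have full X := evert_class_graph sp x0S x0W X (fun=> posE) (fun=> posF).
have pos : 0 < lcount n.+1 x0 (E n) + lcount n.+1 x0 (F n) by rewrite addn_gt0 posE.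
have disj X : side phi F E n X -> X <> S n -> ~ side phi E F n X.
  exact: (middle_sides_disjoint sp SF leaf).
exists (lcount n.+1 x0 (E n) + lcount n.+1 x0 (F n)); split.
- by split; [apply: (middle_end_vertex sp)|apply: (middle_end_vertex sp')].
- split; first exact: (middle_end_index sp).
  by rewrite addnC; apply: (middle_end_index sp') => //; rewrite addnC.
- by rewrite (eidx_middle_loop sp SE SF x0S) (eidx_middle_loop sp' SF SE x0S).
- by rewrite posE /= -[X in X < _]addn0 ltn_add2l.
pose h (z : set T + set T) :=
  match z with inl D => uncoarsen S E n D | inr D => uncoarsen S F n D end.
have inr_evert Z : evert (class_graph_pred phi S F n) Z /\ Z <> S n <->
    exists X, [/\ side phi F E n X, Z = coarsen S F n X & X <> S n].
  split=> [[/(evert_pred n sp')[X EX ->] XS]|[X [EX -> XS]]].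
    by exists X; split=> // E'; apply: XS; rewrite E' coarsen_special.
  split; first by apply/(evert_pred n sp'); exists X.
  by apply/eqP; rewrite (coarsen_eq_special sp' SF); apply/eqP.
apply: (@eisom_of_inverse _ _ _ _ h (inl (E n))).
  split.
  - move=> [Z|Z] /=.
      move=> /(evert_pred n sp)[X EX ->]; have [_ [u uX]] := side_lev sp EX; subst X.
      by rewrite (coarsenK _ _ sp); apply/full; left.
    move=> /inr_evert[X [EX -> _]]; have [_ [u uX]] := side_lev sp' EX; subst X.
    by rewrite (coarsenK _ _ sp'); apply/full; right.
  - move=> [Z|Z] [Z'|Z'] /set_mem + /set_mem /=.
    + move=> /(evert_pred n sp)[X EX ->] /(evert_pred n sp)[X' EX' ->].
      have [_ [u uX]] := side_lev sp EX; have [_ [u' uX']] := side_lev sp EX'; subst X X'.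
      by rewrite !(coarsenK _ _ sp) => ->.
    + move=> /(evert_pred n sp)[X EX ->] /inr_evert[X' [EX' -> XS']].
      have [_ [u uX]] := side_lev sp EX; have [_ [u' uX']] := side_lev sp' EX'; subst X X'.
      by rewrite (coarsenK _ _ sp) (coarsenK _ _ sp') => uu; case: (disj _ EX' XS'); rewrite -uu.
    + move=> /inr_evert[X [EX -> XS]] /(evert_pred n sp)[X' EX' ->].
      have [_ [u uX]] := side_lev sp' EX; have [_ [u' uX']] := side_lev sp EX'; subst X X'.
      by rewrite (coarsenK _ _ sp) (coarsenK _ _ sp') => uu; case: (disj _ EX XS); rewrite uu.
    + move=> /inr_evert[X [EX -> _]] /inr_evert[X' [EX' -> _]].
      have [_ [u uX]] := side_lev sp' EX; have [_ [u' uX']] := side_lev sp' EX'; subst X X'.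
      by rewrite !(coarsenK _ _ sp') => ->.
  - have inl_onto X : side phi E F n X ->
        exists2 z, evert (class_graph_pred phi S E n) z & uncoarsen S E n z = X.
      move=> EX; have [_ [u uX]] := side_lev sp EX; subst X.
      exists (coarsen S E n (lev n.+1 u)); last exact: (coarsenK _ _ sp).
      by apply/(evert_pred n sp); exists (lev n.+1 u).
    move=> X /full[/inl_onto[z ? ?]|EX]; first by exists (inl z).
    (* The identified vertex [S n] lies on both sides and is represented on the left. *)
    have [XS|XS] := pselect (X = S n).
      by have [|z ? ?] := inl_onto X; [rewrite XS; apply: (middle_side_special sp)|exists (inl z)].
    have [_ [u uX]] := side_lev sp' EX; subst X; exists (inr (coarsen S F n (lev n.+1 u))).
      by apply/inr_evert; exists (lev n.+1 u).
    exact: (coarsenK _ _ sp').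
have sepE X : side phi E F n X -> X <> S n -> ~ adj n X (F n) :=
  @middle_side_adj _ _ _ _ _ sp SF X.
have sepF X : side phi F E n X -> X <> S n -> ~ adj n X (E n) :=
  @middle_side_adj _ _ _ _ _ sp' SE X.
have x0E X : side phi E F n X -> X <> S n -> X <> E n -> lcount n.+1 x0 X = 0.
  move=> EX XS XE; apply: lcount_nadj; rewrite x0S => /leaf[//|XF|//].
  by have [/(_ XF)] := side_lev sp EX.
have x0F X : side phi F E n X -> X <> S n -> X <> F n -> lcount n.+1 x0 X = 0.
  move=> EX XS XE; apply: lcount_nadj; rewrite x0S => /leaf[XF|//|//].
  by have [/(_ XF)] := side_lev sp' EX.
have Ss := middle_side_special sp SF; have Ss' := middle_side_special sp' SE.
move=> [Z|Z] [Z'|Z'] /=.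
- move=> /(evert_pred n sp)[X EX ->] /(evert_pred n sp)[X' EX' ->].
  have [u [uX ux0 idx idx']] := side_rep sp x0S x0W EX.
  have [_ [u' uX']] := side_lev sp EX'; subst X X'.
  rewrite !(coarsenK _ _ sp) !(coarsen_eq_special sp SE) [LHS]idx.
  have [uS|/eqP uS] := eqVneq (lev n.+1 u) (S n) => /=; last first.
    rewrite idx' //; case: eqP => [|_]; last by rewrite addn0.
    by rewrite (@lcount_nadj n u (F n)) ?addn0 //; apply: sepE.
  have {ux0}ux0 := ux0 uS; subst u.
  have [u'S|/eqP u'S] := eqVneq (lev n.+1 u') (S n) => /=.
    by rewrite idx' // u'S; case: eqP => [/SE//|_]; rewrite addn0.
  move: (idx' _ EX'); rewrite x0S (coarsen_special SE) => ->.
  have [->|/eqP u'E] := eqVneq (lev n.+1 u') (E n); first by rewrite pos.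
  by rewrite (x0E _ EX').
- move=> /(evert_pred n sp)[X EX ->] /inr_evert[X' [EX' -> XS']].
  have [u [uX ux0 idx _]] := side_rep sp x0S x0W EX.
  have [_ [u' uX']] := side_lev sp' EX'; subst X X'.
  rewrite (coarsenK _ _ sp) (coarsenK _ _ sp') (coarsen_eq_special sp SE) [LHS]idx.
  have [uS|/eqP uS] := eqVneq (lev n.+1 u) (S n); last first.
    apply: lcount_nadj => auu'; have [u'F|] := side_step EX auu'; last exact: disj.
    by apply: (sepE _ EX uS); rewrite -u'F.
  have {ux0}ux0 := ux0 uS; subst u.
  have [v [vS vx0 _ /(_ _ EX')]] := side_rep sp' x0S x0W Ss'.
  have {vx0}vx0 := vx0 erefl; subst v.
  rewrite (coarsen_special SF) => ->; have [->|/eqP u'F] := eqVneq (lev n.+1 u') (F n).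
    by rewrite addnC pos addKn.
  by rewrite (x0F _ EX').
- move=> /inr_evert[X [EX -> XS]] /(evert_pred n sp)[X' EX' ->].
  have [u [uX ux0 idx idx']] := side_rep sp' x0S x0W EX.
  have [_ [u' uX']] := side_lev sp EX'; subst X X'.
  rewrite (coarsenK _ _ sp) (coarsenK _ _ sp') (coarsen_eq_special sp SE) [LHS]idx.
  have [u'S|/eqP u'S] := eqVneq (lev n.+1 u') (S n).
    by move: (idx' _ Ss'); rewrite (coarsen_special SF) u'S => ->;
       case: eqP => [/SF//|_]; rewrite addn0.
  apply: lcount_nadj; rewrite class_adj_sym => au'u.
  have [uF|] := side_step EX' au'u; last exact: disj.
  by apply: (sepE _ EX' u'S); rewrite -uF.
- move=> /inr_evert[X [EX -> XS]] /inr_evert[X' [EX' -> XS']].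
  have [u [uX ux0 idx /(_ _ EX') ->]] := side_rep sp' x0S x0W EX.
  have [_ [u' uX']] := side_lev sp' EX'; subst X X'.
  rewrite !(coarsenK _ _ sp') [LHS]idx; case: eqP => [|_]; last by rewrite addn0.
  by rewrite (@lcount_nadj n u (E n)) ?addn0 //; apply: sepF.
Qed.

End Graphs.

(** * Concatenation steps *)

Section Steps.
Variables (d : nat) (T : regular_tree d) (phi : T -> color).
Hypothesis phi_acyclic : acyclic_coloring phi.
Implicit Types (S E F C : nat -> set T) (X Y Z : set T).

Local Notation lev := (lev phi).
Local Notation lcount := (lcount phi).
Local Notation adj := (class_adj phi).

Lemma center_pred S E F C n : splitting phi S E F C ->
  S n = E n \/ S n = F n -> class_pred C n = class_pred S n.
Proof. by case: n => [//|n] sp; apply: center_special sp. Qed.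

(** Since [C n] differs from [S n], it survives unchanged as [S n.+1], which is adjacent to
    [E n.+1]. Its count is the same at both radii. *)
Lemma center_lcount S E F C n x : splitting phi S E F C -> C n <> S n ->
  lev n.+2 x = E n.+1 -> 0 < lcount n.+1 x (C n).
Proof.
move=> sp CS xE; have [z zS zC] := sp_center sp n.
have zC' : lev n.+2 z = C n by rewrite (sp_keep sp (n := n.+1)) zC.
have SC : S n.+1 = C n by rewrite -zS.
have := adj_SE n.+1 sp; rewrite SC class_adj_sym => /class_adj_lcountP[y yE].
rewrite (@lcount_keep _ _ _ _ _ _ _ n.+1 y (C n) sp) ?(lcount_lev _ (etrans xE (esym yE))) //.
- by rewrite -zC; apply: lev_neqE sp.
- by rewrite -zC; apply: lev_neqF sp.
Qed.

(** By [F_nbr_center], [F n] is [C n]. Any further neighbor of [S n] would be [C n] as well, so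
    [S n] is a leaf and [leaf_special] descends to all smaller radii. *)
Lemma special_F_nbr S E F C n x : splitting phi S E F C -> S n = E n ->
  lev n.+2 x = E n.+1 -> 0 < lcount n.+1 x (F n) ->
  F n = C n /\ forall m, m < n -> S m = E m /\ E m = C m.
Proof.
move=> sp SE xE xF; have FS : F n <> S n by rewrite SE; apply/nesym/(sp_neq sp).
have FC := F_nbr_center phi_acyclic sp FS xE xF; split=> //.
apply: (leaf_special phi_acyclic sp SE) => X SX.
have [->|XE] := pselect (X = E n); first by left.
have [->|XF] := pselect (X = F n); first by right.
by case: (XF); rewrite FC; apply: (other_nbr_center phi_acyclic sp SX); rewrite ?SE.
Qed.

(** Another neighbor would be the preceding [E] by [nbr_E_center]; this is the preceding special
    class, which has split and is no longer a class. *)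
Lemma special_E_leaf S E F C n : splitting phi S E F C -> S n = E n ->
  (forall m, m < n -> S m = E m) -> forall X, adj n (S n) X -> X = E n \/ X = F n.
Proof.
move=> sp; case: n => [|n] SE Sm X SX; have [_ [x [_ _ xX]]] := class_adjP SX; subst X.
  exact: (sp_cases sp).
have [->|xE] := pselect (lev n.+2 x = E n.+1); first by left.
have [->|xF] := pselect (lev n.+2 x = F n.+1); first by right.
case: (@lev_neq_pred _ _ phi S E F C n.+1 x sp); rewrite /= Sm //.
rewrite SE in SX; apply: (nbr_E_center phi_acyclic sp _ SX) => //; by left.
Qed.

Section Level.
Variables (S A B C : nat -> set T) (n : nat).
Hypothesis sp : splitting phi S A B C.

Let sp' := splitting_sym sp.
Local Notation GA := (class_graph phi S A n).
Local Notation GB := (class_graph phi S B n).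
Local Notation GA' := (class_graph_pred phi S A n).
Local Notation GB' := (class_graph_pred phi S B n).
Local Notation C' := (class_pred C n).

Lemma step_special_A x : S n = A n -> lev n.+2 x = A n.+1 -> lcount n.+1 x (B n) = 0 ->
  GA ≅ GA' /\ exists i j, isom_concat2 GB GA' C' GB' C' i j.
Proof.
move=> SA xA x0; have SAB : S n = A n \/ S n = B n by left.
have SB : S n <> B n by rewrite SA; apply: sp_neq sp n.
have [y yS yB] := sp_F sp n.+1; have [z _ zB] := sp_F sp n; split.
  by apply: (class_graph_isom_pred phi_acyclic sp (lev_E sp xA)).
exists (lcount n.+1 y (B n)), (lcount n.+1 z (A n)).
apply: (class_graph_concat2 phi_acyclic sp SAB (center_pred sp SAB) yS (esym yB)) => //.
- by move=> _; apply: leq_ltn_trans (sp_moreF sp xA yB).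
- by rewrite [lev _ _]yS.
Qed.

(** Both extensions see [B n], so both graphs have an edge between the sides. [sp_moreF] gives
    [i < i'], and [j] is common since it is counted at [B n], which is not special. *)
Lemma step_special_A_full x y : S n = A n -> lev n.+2 x = A n.+1 -> lev n.+2 y = B n.+1 ->
  0 < lcount n.+1 x (B n) ->
  exists i i' j, i < i' /\ isom_concat2 GA GA' C' GB' C' i j /\ isom_concat2 GB GA' C' GB' C' i' j.
Proof.
move=> SA xA yB xpos; have SAB : S n = A n \/ S n = B n by left.
have SB : S n <> B n by rewrite SA; apply: sp_neq sp n.
have [z _ zB] := sp_F sp n; have xS : lev n.+1 x = S n := lev_E sp xA.
have yS : lev n.+1 y = S n := lev_F sp yB.
have lt := sp_moreF sp xA yB.
exists (lcount n.+1 x (B n)), (lcount n.+1 y (B n)), (lcount n.+1 z (A n)); split=> //; split.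
  apply: (class_graph_concat2 phi_acyclic sp SAB (center_pred sp SAB) xS (esym xA)) => //.
  by rewrite xS.
apply: (class_graph_concat2 phi_acyclic sp SAB (center_pred sp SAB) yS (esym yB)) => //.
- by move=> _; apply: leq_ltn_trans lt.
- by rewrite yS.
Qed.

Lemma step_special_B y : S n = B n -> lev n.+2 y = B n.+1 -> lcount n.+1 y (A n) = 0 ->
  GB ≅ GB' /\ exists i j, isom_concat2 GA GA' C' GB' C' i j.
Proof.
move=> SB yB y0; have SAB : S n = A n \/ S n = B n by right.
have SA : S n <> A n by rewrite SB; apply/nesym/(sp_neq sp).
have [x xS xA] := sp_E sp n.+1; have [z _ zA] := sp_E sp n; split.
  by apply: (class_graph_isom_pred phi_acyclic sp' (lev_F sp yB)).
exists (lcount n.+1 z (B n)), (lcount n.+1 x (A n)).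
apply: (class_graph_concat2 phi_acyclic sp SAB (center_pred sp SAB) xS (esym xA)) => //.
- by move=> _; apply: leq_ltn_trans (sp_moreE sp xA yB).
- by rewrite [lev _ _]xS.
Qed.

(** By [F_nbr_center], [A n.+1] can see [B n] only if [B n = C n], and symmetrically. When one of
    these equalities holds, [other_nbr_center] leaves [S n] no neighbor besides [A n], [B n] and
    itself, and [center_lcount] supplies the missing positive index. *)
Lemma step_middle : S n <> A n -> S n <> B n ->
  (~ concat_level S A B C n -> GA ≅ GA' /\ GB ≅ GB') /\
  (concat_level S A B C n ->
    (isom_concat GA GA' C' GB' C' /\ GB ≅ GB') \/ (GA ≅ GA' /\ isom_concat GB GA' C' GB' C')).
Proof.
move=> SA SB; have [x xS xA] := sp_E sp n.+1; have [y yS yB] := sp_F sp n.+1.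
have xpos : 0 < lcount n.+1 x (A n) by apply: leq_ltn_trans (sp_moreE sp xA yB).
have ypos : 0 < lcount n.+1 y (B n) by apply: leq_ltn_trans (sp_moreF sp xA yB).
have isoA : B n <> C n -> GA ≅ GA'.
  move=> BC; apply: (class_graph_isom_pred phi_acyclic sp xS) => //.
  apply/eqP; rewrite -leqn0 leqNgt; apply/negP => h; apply: BC.
  by apply: (F_nbr_center phi_acyclic sp _ xA h); apply: nesym.
have isoB : A n <> C n -> GB ≅ GB'.
  move=> hAC; apply: (class_graph_isom_pred phi_acyclic sp' yS) => //.
  apply/eqP; rewrite -leqn0 leqNgt; apply/negP => h; apply: hAC.
  by apply: (F_nbr_center phi_acyclic sp' _ yB h); apply: nesym.
have CS : C' = S n.
  case: n SA SB => [|m] SA SB; first by have [] := special0 sp.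
  by have [] := center_keep sp SA SB.
have leaf : A n = C n \/ B n = C n ->
    forall X, adj n (S n) X -> [\/ X = A n, X = B n | X = S n].
  move=> ABC X SX; have [->|XA] := pselect (X = A n); first by constructor 1.
  have [->|XB] := pselect (X = B n); first by constructor 2.
  have [->|XS] := pselect (X = S n); first by constructor 3.
  have XC := other_nbr_center phi_acyclic sp SX XA XB XS.
  by case: ABC => h; [case: XA|case: XB]; rewrite h.
split=> [ncl|cl].
  by split; [apply: isoA => h; apply: ncl; constructor 4|
             apply: isoB => h; apply: ncl; constructor 2].
have AB := sp_neq sp (n := n).
have [hAC|BC] : A n = C n \/ B n = C n.
  by case: cl => [/esym//|h|/esym//|h]; [left|right].
- right; split; first by apply: isoA; rewrite -hAC; apply: nesym.
  left; exists (lcount n.+1 y (A n)).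
  apply: (class_graph_concat1 phi_acyclic sp SA SB) => //; first by apply: leaf; left.
  by rewrite hAC; apply: (center_lcount sp' _ yB); rewrite -hAC; apply: nesym.
- left; split; last by apply: isoB; rewrite -BC.
  left; exists (lcount n.+1 x (A n)).
  apply: (class_graph_concat1 phi_acyclic sp SA SB) => //; first by apply: leaf; right.
  by rewrite BC; apply: (center_lcount sp _ xA); rewrite -BC; apply: nesym.
Qed.

End Level.

End Steps.

Theorem theorem3p5 (d : nat) (T : regular_tree d) (phi : T -> color)
  (S A B C : nat -> set T)
  (phi_sturmian : sturmian phi) (phi_acyclic : acyclic_coloring phi)
  (names : naming phi S A B C) :
  let GA := class_graph phi S A in
  let GB := class_graph phi S B in
  let GA' := class_graph_pred phi S A in
  let GB' := class_graph_pred phi S B in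
  let C' := class_pred C in
  exists K : option nat,
    (* for n = -1, the equivalence holds by convention *)
    (forall n, (S n = A n /\ A n = C n) <-> lt_ext n K) /\
    (* (1) *)
    (forall n, lt_ext n K ->
       (A n = C n /\ C n = S n) /\
       GA n ≅ GA' n /\
       exists i j, isom_concat2 (GB n) (GA' n) (C' n) (GB' n) (C' n) i j) /\
    (* (2) *)
    (forall n, K = Some n ->
       ((A n = S n /\ B n = C n) /\
        exists i i' j, i < i' /\
          isom_concat2 (GA n) (GA' n) (C' n) (GB' n) (C' n) i j /\
          isom_concat2 (GB n) (GA' n) (C' n) (GB' n) (C' n) i' j) \/
       (B n = S n /\
        (exists2 n', n = n'.+1 & unique_extension phi n' (B n') (C n)) /\
        (exists i j, isom_concat2 (GA n) (GA' n) (C' n) (GB' n) (C' n) i j) /\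
        GB n ≅ GB' n)) /\
    (* (3) *)
    (forall n, gt_ext n K ->
       (~ concat_level S A B C n -> GA n ≅ GA' n /\ GB n ≅ GB' n) /\
       (concat_level S A B C n ->
          (isom_concat (GA n) (GA' n) (C' n) (GB' n) (C' n) /\ GB n ≅ GB' n) \/
          (GA n ≅ GA' n /\ isom_concat (GB n) (GA' n) (C' n) (GB' n) (C' n)))).
Proof.
move=> GA GB GA' GB' C'.
have sp := splitting_of_naming phi_sturmian names; have sp' := splitting_sym sp.
pose P n := S n = A n /\ A n = C n.
(* Under [P n] the special class is a leaf, any other neighbor being [C n = A n]. *)
have below n : P n -> forall m, m < n -> P m.
  move=> [SA hAC]; apply: (leaf_special phi_acyclic sp SA) => X SX.
  have [->|XA] := pselect (X = A n); first by left.
  have [->|XB] := pselect (X = B n); first by right.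
  by case: (XA); rewrite hAC; apply: (other_nbr_center phi_acyclic sp SX); rewrite ?SA.
(* As [P] is inherited by smaller radii, [K] is the least radius where it fails, or infinity. *)
have [K KP] : exists K, forall n, P n <-> lt_ext n K.
  pose nP n := ~~ `[<P n>]; have [exP|allP] := pselect (exists n, nP n); last first.
    by exists None => n; split=> // _; apply: contrapT => /asboolPn nPn; apply: allP; exists n.
  have [k0 /asboolPn nPk0 min] := ex_minnP exP; exists (Some k0) => n.
  split=> [Pn|nk]; last first.
    by apply: contrapT => /asboolPn /min; rewrite leqNgt nk.
  rewrite /= ltnNge leq_eqVlt; apply/negP => /predU1P[nk|kn]; apply: nPk0; first by rewrite nk.
  exact: below kn.
(* A neighbor in [B n] would force [B n = C n] and [P m] for all [m < n]. *)
have zeroA n x : S n = A n -> lev phi n.+2 x = A n.+1 ->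
    (P n \/ exists2 m, m < n & ~ P m) -> lcount phi n.+1 x (B n) = 0.
  move=> SA xA hP; apply/eqP; rewrite -leqn0 leqNgt; apply/negP => pos.
  have [BC Pm] := special_F_nbr phi_acyclic sp SA xA pos.
  case: hP => [[_ hAC]|[m mn]]; last by apply; apply: Pm.
  by apply: (sp_neq sp (n := n)); rewrite hAC.
(* A neighbor in [A n] would carry the equality with [B] down to radius 0, against [S 0 = A 0]. *)
have zeroB n y : S n = B n -> lev phi n.+2 y = B n.+1 -> lcount phi n.+1 y (A n) = 0.
  move=> SB yB; apply/eqP; rewrite -leqn0 leqNgt; apply/negP => pos.
  have [_ Pm] := special_F_nbr phi_acyclic sp' SB yB pos.
  case: n SB {yB pos} Pm => [|n] SB Pm.
    by apply: (sp_neq sp (n := 0)); rewrite -SB (nm_S0 names).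
  by have [S0 _] := Pm 0 isT; apply: (sp_neq sp (n := 0)); rewrite -S0 (nm_S0 names).
exists K; split; first exact: KP.
split.
  move=> n /KP Pn; have [SA hAC] := Pn; split; first by rewrite -hAC -SA.
  have [x _ xA] := sp_E sp n.+1.
  by apply: (step_special_A phi_acyclic sp SA xA); apply: zeroA => //; left.
split.
  move=> n Kn; rewrite {}Kn in KP.
  have nPn : ~ P n by move=> /KP /=; rewrite ltnn.
  have Pm m : m < n -> P m by move=> mn; apply/KP.
  have [x xS xA] := sp_E sp n.+1; have [y yS yB] := sp_F sp n.+1.
  (* Otherwise [C] and [S] would differ at radius [n - 1], where [P] holds. *)
  have [SA|SB] : S n = A n \/ S n = B n.
    case: (n) Pm => [|m] Pm; first exact: (special0 sp).
    apply: contrapT => /not_orP[SA SB]; have [_ CS] := center_keep sp SA SB.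
    by have [Sm Am] := Pm m (leqnn _); apply: CS; rewrite -Am.
  - left; have leaf := special_E_leaf phi_acyclic sp SA (fun m mn => (Pm m mn).1).
    have CS : C n <> S n by move=> CS; apply: nPn; split=> //; rewrite CS SA.
    have posC := center_lcount sp CS xA.
    have BC : B n = C n.
      have [|CA|//] := leaf (C n); last by case: CS; rewrite CA.
      by rewrite -[S n]xS; apply: class_adj_lcount.
    by split=> //; apply: (step_special_A_full phi_acyclic sp SA xA yB); rewrite BC.
  - right; split=> //.
    have [isoB concA] := step_special_B phi_acyclic sp SB yB (zeroB n y SB yB).
    split; last by split.
    case: n SB Pm {x y nPn xS xA yS yB isoB concA KP} => [|m] SB Pm.
      by case: (sp_neq sp (n := 0)); rewrite -SB (nm_S0 names).
    exists m => //; have [Sm _] := Pm m (leqnn _).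
    have BS : B m <> S m by rewrite Sm; apply/nesym/(sp_neq sp).
    have [x _ xA] := sp_E sp m.+1; have [y _ yB] := sp_F sp m.+1; have [z _ zB] := sp_F sp m.
    have zB' : lev phi m.+2 z = B m by rewrite (sp_keep sp (n := m.+1)) zB.
    (* The class [B m] survives as a neighbor of [B m.+1], which is here the special class. Its
       unique extension has the same set of centers. *)
    have BC : B m = C m.+1.
      apply: (other_nbr_center phi_acyclic sp).
      + rewrite SB -yB class_adj_sym; apply: (adj_lift sp BS).
        exact: leq_ltn_trans (sp_moreF sp xA yB).
      + by rewrite -zB; apply: lev_neqE sp.
      + by rewrite -zB; apply: lev_neqF sp.
      + by rewrite SB -zB; apply: lev_neqF sp.
    move=> E; split=> [[u [-> Bu]]|->]; last by exists z; rewrite -BC -{1}zB' -zB.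
    rewrite -BC Bu; apply: (sp_keep sp (n := m.+1)) => h.
    by apply: BS; rewrite Bu.
(* The radius [k] is [K] itself; the failure of [P] there activates [zeroA] at [n]. *)
move=> n nK; have [k nPk kn] : exists2 k, ~ P k & k < n.
  by case: (K) nK KP => //= k kn KP; exists k => // /KP; rewrite ltnn.
have [x xS xA] := sp_E sp n.+1; have [y yS yB] := sp_F sp n.+1.
have [SA|SA] := pselect (S n = A n).
  split=> [[]|_]; first by constructor 1.
  right; have x0 : lcount phi n.+1 x (B n) = 0 by apply: zeroA => //; right; exists k.
  by have [isoA concB] := step_special_A phi_acyclic sp SA xA x0; split=> //; right.
have [SB|SB] := pselect (S n = B n).
  split=> [[]|_]; first by constructor 3.
  left; have [isoB concA] := step_special_B phi_acyclic sp SB yB (zeroB n y SB yB).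
  by split=> //; right.
exact: (step_middle phi_acyclic sp SA SB).
Qed.
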